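(* Let $A$ be a commutative ring, $E$ an $A$-module, $R = A\ltimes E$ the trivial ring extension of $A$ by $E$, and let $M$ be an $A$-module. Then: (1) Suppose that $\mathrm{pd}_A(E)<\infty$. If $M$ is a Gorenstein projective $A$-module, then $M\otimes_A R$ is a Gorenstein projective $R$-module. (2) Suppose that $\mathrm{Ext}_A^p(R,M)=0$ for all $p\geq 1$ and $\mathrm{fd}_A(R)<\infty$. If $M$ is a Gorenstein injective $A$-module, then $\mathrm{Hom}_A(R,M)$ is a Gorenstein injective $R$-module.
   Context: All rings are commutative with identity and all modules are unital. $\mathrm{pd}$ and $\mathrm{fd}$ denote projective and flat dimension. The trivial ring extension $A\ltimes E$ of a ring $A$ by an $A$-module $E$ is the ring with underlying additive group $A\times E$ and multiplication $(a,e)(a',e')=(aa',ae'+a'e)$; it is an $A$-algebra via $a\mapsto(a,0)$. Let $S$ be a ring. An $S$-module $N$ is Gorenstein projective if there is an exact complex $\cdots\to P_1\to P_0\to P^0\to P^1\to\cdots$ of projective $S$-modules with $N\cong\mathrm{Im}(P_0\to P^0)$ that remains exact after applying $\mathrm{Hom}_S(-,Q)$ for every projective $S$-module $Q$. Dually, $N$ is Gorenstein injective if there is an exact complex $\cdots\to I_1\to I_0\to I^0\to I^1\to\cdots$ of injective $S$-modules with $N\cong\mathrm{Im}(I_0\to I^0)$ that remains exact after applying $\mathrm{Hom}_S(J,-)$ for every injective $S$-module $J$. *)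

(* Defs.v *)
From HB Require Import structures.
From mathcomp Require Import all_boot all_algebra.
From mathcomp Require Import generic_quotient.
From mathcomp Require Import boolp.

Set Implicit Arguments.
Unset Strict Implicit.
Unset Printing Implicit Defensive.

Import GRing.Theory.
Local Open Scope ring_scope.
Local Open Scope quotient_scope.

(* Rings are [comPzRingType]s, which include the zero ring; the algebra
   structures of MathComp exclude it, so an algebra over [A] is given by its
   structure morphism [f : {rmorphism A -> B}]. *)

(** * The trivial ring extension *)

Section TrivialExtension.
Variables (A : comPzRingType) (E : lmodType A).

Definition trivext : Type := (A * E)%type.

HB.instance Definition _ := GRing.Zmodule.copy trivext (A * E)%type.

Definition trivext_one : trivext := (1, 0).
Definition trivext_mul (x y : trivext) : trivext :=
  (x.1 * y.1, x.1 *: y.2 + y.1 *: x.2).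

Fact trivext_mulA : associative trivext_mul.
Proof.
move=> x y z; congr pair => /=; first exact: mulrA.
by rewrite !scalerDr !scalerA addrA [z.1 * x.1]mulrC [z.1 * y.1]mulrC.
Qed.

Fact trivext_mulC : commutative trivext_mul.
Proof. by move=> x y; congr pair => /=; [exact: mulrC | exact: addrC]. Qed.

Fact trivext_mul1r : left_id trivext_one trivext_mul.
Proof.
by move=> [a e]; congr pair; rewrite /= ?mul1r // scale1r scaler0 addr0.
Qed.

Fact trivext_mulDl : left_distributive trivext_mul +%R.
Proof.
move=> x y z; congr pair => /=; first exact: mulrDl.
by rewrite scalerDl scalerDr addrACA.
Qed.

HB.instance Definition _ := GRing.Zmodule_isComPzRing.Build trivext
  trivext_mulA trivext_mulC trivext_mul1r trivext_mulDl.

Definition trivext_in (a : A) : trivext := (a, 0).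

Fact trivext_in_zmod_morphism : zmod_morphism trivext_in.
Proof. by move=> a b; congr pair; rewrite subr0. Qed.

Fact trivext_in_monoid_morphism : monoid_morphism trivext_in.
Proof.
by split=> // a b; congr pair; rewrite /= !scaler0 addr0.
Qed.

HB.instance Definition _ :=
  GRing.isZmodMorphism.Build A trivext trivext_in trivext_in_zmod_morphism.
HB.instance Definition _ :=
  GRing.isMonoidMorphism.Build A trivext trivext_in trivext_in_monoid_morphism.

End TrivialExtension.

(** * Restriction of scalars *)

Section Restriction.
Variables (A B : comPzRingType) (f : {rmorphism A -> B}) (N : lmodType B).

(* [N] as an [A]-module through [f]; the argument [f] is a phantom by which
   the module structure is inferred. *)
Definition restr (_ : {rmorphism A -> B}) : Type := N.
Local Notation restrf := (restr f).

HB.instance Definition _ := GRing.Zmodule.copy restrf N.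

Definition restr_scale (a : A) (v : restrf) : restrf := f a *: (v : N).

Fact restr_scalerA a b v :
  restr_scale a (restr_scale b v) = restr_scale (a * b) v.
Proof. by rewrite /restr_scale scalerA rmorphM. Qed.
Fact restr_scale1r : left_id 1 restr_scale.
Proof. by move=> v; rewrite /restr_scale rmorph1 scale1r. Qed.
Fact restr_scalerDr : right_distributive restr_scale +%R.
Proof. by move=> a u v; exact: scalerDr. Qed.
Fact restr_scalerDl v : {morph restr_scale^~ v : a b / a + b}.
Proof. by move=> a b; rewrite /restr_scale rmorphD scalerDl. Qed.

HB.instance Definition _ := GRing.Zmodule_isLmodule.Build A restrf
  restr_scalerA restr_scale1r restr_scalerDr restr_scalerDl.

End Restriction.

(* [B] as an [A]-module through [f : A -> B]. *)
Definition algmod (A B : comPzRingType) (f : {rmorphism A -> B}) : lmodType A :=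
  restr B^o f.

(* The [A]-module structure of [A |x E] is that of the product [A x E]. *)
Lemma algmod_trivextE (A : comPzRingType) (E : lmodType A) (a b : A) (e : E) :
  a *: ((b, e) : algmod (trivext_in E)) = (a * b, a *: e) :> (A * E)%type.
Proof. by congr pair; rewrite /= scaler0 addr0. Qed.

(** * Modules of homomorphisms *)

Section Hom.
Variables (A : comPzRingType) (X Y : lmodType A).

Definition hom : Type := {linear X -> Y}.

Lemma homP (f g : hom) : f =1 g -> f = g.
Proof.
case: f g => [f [[fA] [fZ]]] [g [[gA] [gZ]]] /= /funext fg.
move: fA fZ gA gZ; rewrite {f}fg => fA fZ gA gZ.
by rewrite (Prop_irrelevance fA gA) (Prop_irrelevance fZ gZ).
Qed.

HB.instance Definition _ := gen_eqMixin hom.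
HB.instance Definition _ := gen_choiceMixin hom.

Definition hom_zero : hom := \0%R.
Definition hom_add (f g : hom) : hom := f \+ g.
Definition hom_opp (f : hom) : hom := \- f.
Definition hom_scale (a : A) (f : hom) : hom := a \*: f.

Fact hom_addA : associative hom_add.
Proof. by move=> f g h; apply: homP => x; exact: addrA. Qed.
Fact hom_addC : commutative hom_add.
Proof. by move=> f g; apply: homP => x; exact: addrC. Qed.
Fact hom_add0r : left_id hom_zero hom_add.
Proof. by move=> f; apply: homP => x; exact: add0r. Qed.
Fact hom_addNr : left_inverse hom_zero hom_opp hom_add.
Proof. by move=> f; apply: homP => x; exact: addNr. Qed.

HB.instance Definition _ :=
  GRing.isZmodule.Build hom hom_addA hom_addC hom_add0r hom_addNr.

Fact hom_scalerA a b f : hom_scale a (hom_scale b f) = hom_scale (a * b) f.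
Proof. by apply: homP => x; exact: scalerA. Qed.
Fact hom_scale1r : left_id 1 hom_scale.
Proof. by move=> f; apply: homP => x; exact: scale1r. Qed.
Fact hom_scalerDr : right_distributive hom_scale +%R.
Proof. by move=> a f g; apply: homP => x; exact: scalerDr. Qed.
Fact hom_scalerDl f : {morph hom_scale^~ f : a b / a + b}.
Proof. by move=> a b; apply: homP => x; exact: scalerDl. Qed.

HB.instance Definition _ := GRing.Zmodule_isLmodule.Build A hom
  hom_scalerA hom_scale1r hom_scalerDr hom_scalerDl.

End Hom.

(** * Tensor products *)

Section Tensor.
Variables (A : comPzRingType) (X Y : lmodType A).

(* The list [:: (x1, y1); ...; (xn, yn)] stands for the formal sum
   x1 (x) y1 + ... + xn (x) yn. *)
Inductive tensor_rel : seq (X * Y) -> seq (X * Y) -> Prop :=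
| tensor_rel_refl s : tensor_rel s s
| tensor_rel_sym s t : tensor_rel s t -> tensor_rel t s
| tensor_rel_trans s t u : tensor_rel s t -> tensor_rel t u -> tensor_rel s u
| tensor_rel_cat s s' t t' :
    tensor_rel s s' -> tensor_rel t t' -> tensor_rel (s ++ t) (s' ++ t')
| tensor_rel_comm s t : tensor_rel (s ++ t) (t ++ s)
| tensor_rel_zero y : tensor_rel [:: (0, y)] [::]
| tensor_rel_addl x x' y : tensor_rel [:: (x + x', y)] [:: (x, y); (x', y)]
| tensor_rel_addr x y y' : tensor_rel [:: (x, y + y')] [:: (x, y); (x, y')]
| tensor_rel_scale a x y : tensor_rel [:: (a *: x, y)] [:: (x, a *: y)].

Definition tensor_relb (s t : seq (X * Y)) : bool := `[< tensor_rel s t >].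

Fact tensor_relb_refl : reflexive tensor_relb.
Proof. by move=> s; apply/asboolP; exact: tensor_rel_refl. Qed.
Fact tensor_relb_sym : symmetric tensor_relb.
Proof. by move=> s t; apply/asboolP/asboolP; exact: tensor_rel_sym. Qed.
Fact tensor_relb_trans : transitive tensor_relb.
Proof.
by move=> t s u /asboolP st /asboolP tu; apply/asboolP/(tensor_rel_trans st).
Qed.

Canonical tensor_equiv :=
  EquivRel tensor_relb tensor_relb_refl tensor_relb_sym tensor_relb_trans.

Definition tensor : Type := {eq_quot tensor_relb}.
HB.instance Definition _ := Choice.on tensor.

Definition tensor_sum (s : seq (X * Y)) : tensor := \pi_({eq_quot tensor_relb}) s.
Definition tensor_repr (u : tensor) : seq (X * Y) :=
  repr (u : {eq_quot tensor_relb}).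
Definition tens (x : X) (y : Y) : tensor := tensor_sum [:: (x, y)].

Lemma tensor_reprK : cancel tensor_repr tensor_sum.
Proof. exact: reprK. Qed.

Lemma tensor_sumP s t : tensor_sum s = tensor_sum t <-> tensor_rel s t.
Proof.
split=> [/eqP|st]; last by apply/eqP; rewrite eqmodE; apply/asboolP.
by rewrite eqmodE => /asboolP.
Qed.

Lemma tensor_repr_rel s : tensor_rel (tensor_repr (tensor_sum s)) s.
Proof. by apply/tensor_sumP; rewrite tensor_reprK. Qed.

Definition tensor_zero : tensor := tensor_sum [::].
Definition tensor_add (u v : tensor) : tensor :=
  tensor_sum (tensor_repr u ++ tensor_repr v).

Fact tensor_sum_cat s t :
  tensor_sum (s ++ t) = tensor_add (tensor_sum s) (tensor_sum t).
Proof.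
by apply/tensor_sumP/tensor_rel_sym/tensor_rel_cat; exact: tensor_repr_rel.
Qed.

Fact tensor_addA : associative tensor_add.
Proof.
move=> u v w; rewrite -[u]tensor_reprK -[v]tensor_reprK -[w]tensor_reprK.
by rewrite -!tensor_sum_cat catA.
Qed.
Fact tensor_addC : commutative tensor_add.
Proof. by move=> u v; apply/tensor_sumP; exact: tensor_rel_comm. Qed.
Fact tensor_add0r : left_id tensor_zero tensor_add.
Proof. by move=> u; rewrite -[u]tensor_reprK -tensor_sum_cat. Qed.

HB.instance Definition _ :=
  GRing.isNmodule.Build tensor tensor_addA tensor_addC tensor_add0r.

Lemma tensor_sumE s : tensor_sum s = \sum_(p <- s) tens p.1 p.2.
Proof.
elim: s => [|[x y] s IHs]; first by rewrite big_nil.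
by rewrite big_cons -IHs -cat1s tensor_sum_cat.
Qed.

Lemma tensDl x x' y : tens (x + x') y = tens x y + tens x' y.
Proof.
by rewrite -[RHS]tensor_sum_cat; apply/tensor_sumP; exact: tensor_rel_addl.
Qed.
Lemma tensDr x y y' : tens x (y + y') = tens x y + tens x y'.
Proof.
by rewrite -[RHS]tensor_sum_cat; apply/tensor_sumP; exact: tensor_rel_addr.
Qed.
Lemma tensZ a x y : tens (a *: x) y = tens x (a *: y).
Proof. by apply/tensor_sumP; exact: tensor_rel_scale. Qed.
Lemma tens0l y : tens 0 y = 0.
Proof. by apply/tensor_sumP; exact: tensor_rel_zero. Qed.

Definition tensor_opp (u : tensor) : tensor :=
  tensor_sum [seq (- p.1, p.2) | p <- tensor_repr u].

Fact tensor_addNr : left_inverse 0 tensor_opp +%R.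
Proof.
move=> u; rewrite -[X in _ + X]tensor_reprK /tensor_opp !tensor_sumE.
rewrite big_map -big_split.
by apply: big1 => p _ /=; rewrite -tensDl addNr tens0l.
Qed.

HB.instance Definition _ := GRing.Nmodule_isZmodule.Build tensor tensor_addNr.

Definition balanced (V : zmodType) (phi : X -> Y -> V) : Prop :=
  [/\ forall x x' y, phi (x + x') y = phi x y + phi x' y,
      forall x y y', phi x (y + y') = phi x y + phi x y'
    & forall a x y, phi (a *: x) y = phi x (a *: y)].

Definition tensor_lift (V : zmodType) (phi : X -> Y -> V) (u : tensor) : V :=
  \sum_(p <- tensor_repr u) phi p.1 p.2.

Section Lift.
Variables (V : zmodType) (phi : X -> Y -> V).
Hypothesis phiB : balanced phi.

Lemma tensor_lift_sum s :
  tensor_lift phi (tensor_sum s) = \sum_(p <- s) phi p.1 p.2.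
Proof.
have [phiDl phiDr phiZ] := phiB.
have phi0 y : phi 0 y = 0 by apply: (addIr (phi 0 y)); rewrite -phiDl !add0r.
suff rel_sum s1 s2 : tensor_rel s1 s2 ->
    \sum_(p <- s1) phi p.1 p.2 = \sum_(p <- s2) phi p.1 p.2.
  exact/rel_sum/tensor_repr_rel.
elim=> {s1 s2} //=.
- by move=> s1 s2 s3 _ -> _ ->.
- by move=> s1 s1' s2 s2' _ IH1 _ IH2; rewrite !big_cat /= IH1 IH2.
- by move=> s1 s2; rewrite !big_cat /= addrC.
- by move=> y; rewrite big_seq1 big_nil phi0.
- by move=> x x' y; rewrite !big_cons !big_nil !addr0 phiDl.
- by move=> x y y'; rewrite !big_cons !big_nil !addr0 phiDr.
- by move=> a x y; rewrite !big_seq1 phiZ.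
Qed.

Lemma tensor_lift_tens x y : tensor_lift phi (tens x y) = phi x y.
Proof. by rewrite tensor_lift_sum big_seq1. Qed.

Lemma tensor_liftD : {morph tensor_lift phi : u v / u + v}.
Proof.
move=> u v; rewrite -[u]tensor_reprK -[v]tensor_reprK -[_ + _]tensor_sum_cat.
by rewrite !tensor_lift_sum big_cat.
Qed.

Lemma tensor_lift_zmod : zmod_morphism (tensor_lift phi).
Proof.
move=> u v; apply: (addIr (tensor_lift phi v)).
by rewrite -tensor_liftD !subrK.
Qed.

End Lift.

Lemma tensor_ind (P : tensor -> Prop) :
    P 0 -> (forall x y, P (tens x y)) ->
    (forall u v, P u -> P v -> P (u + v)) ->
  forall u, P u.
Proof.
move=> P0 Pt PD u; rewrite -[u]tensor_reprK tensor_sumE.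
by apply: big_ind => // p _; exact: Pt.
Qed.

Lemma tensor_morph_ext (V : zmodType) (g h : tensor -> V) :
    {morph g : u v / u + v} -> {morph h : u v / u + v} ->
    (forall x y, g (tens x y) = h (tens x y)) ->
  g =1 h.
Proof.
move=> gD hD gh; apply: tensor_ind => // [|u v gu gv]; last first.
  by rewrite gD hD gu gv.
have -> : g 0 = 0 by apply: (addIr (g 0)); rewrite -gD !add0r.
by apply: (addIr (h 0)); rewrite -hD !add0r.
Qed.

Definition tensor_scale (a : A) : tensor -> tensor :=
  tensor_lift (fun x y => tens (a *: x) y).

Fact tensor_scale_balanced a : balanced (fun x y => tens (a *: x) y).
Proof.
split=> [x x' y|x y y'|b x y]; first by rewrite scalerDr tensDl.
  exact: tensDr.
by rewrite scalerA mulrC -scalerA tensZ.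
Qed.

Lemma tensor_scale_tens a x y : tensor_scale a (tens x y) = tens (a *: x) y.
Proof. exact/tensor_lift_tens/tensor_scale_balanced. Qed.

Fact tensor_scalerDr : right_distributive tensor_scale +%R.
Proof. by move=> a; exact/tensor_liftD/tensor_scale_balanced. Qed.
Fact tensor_scalerA a b u :
  tensor_scale a (tensor_scale b u) = tensor_scale (a * b) u.
Proof.
move: u; apply: tensor_morph_ext => [u v|u v|x y]; rewrite ?tensor_scalerDr //.
by rewrite !tensor_scale_tens scalerA.
Qed.
Fact tensor_scale1r : left_id 1 tensor_scale.
Proof.
apply: tensor_morph_ext => [u v|u v|x y]; rewrite ?tensor_scalerDr //.
by rewrite !tensor_scale_tens scale1r.
Qed.
Fact tensor_scalerDl u : {morph tensor_scale^~ u : a b / a + b}.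
Proof.
move=> a b; move: u; apply: tensor_morph_ext => [u v|u v|x y].
- exact: tensor_scalerDr.
- by rewrite !tensor_scalerDr addrACA.
- by rewrite !tensor_scale_tens scalerDl tensDl.
Qed.

HB.instance Definition _ := GRing.Zmodule_isLmodule.Build A tensor
  tensor_scalerA tensor_scale1r tensor_scalerDr tensor_scalerDl.

Lemma tensZl a x y : a *: tens x y = tens (a *: x) y.
Proof. exact: tensor_scale_tens. Qed.
Lemma tensZr a x y : a *: tens x y = tens x (a *: y).
Proof. by rewrite tensZl tensZ. Qed.

(* The universal property of [X (x) Y]. *)
Lemma tensor_universal (Z : lmodType A) (phi : X -> Y -> Z) :
    (forall x, linear (phi x)) -> (forall y, linear (phi^~ y)) ->
  exists! g : hom tensor Z, forall x y, g (tens x y) = phi x y.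
Proof.
move=> phil phir.
have phiZl a x y : phi (a *: x) y = a *: phi x y.
  exact: (GRing.scalable_linear (phir y)).
have phiZr a x y : phi x (a *: y) = a *: phi x y.
  exact: (GRing.scalable_linear (phil x)).
have phiB : balanced phi.
  split=> [x x' y|x y y'|a x y]; last by rewrite phiZl phiZr.
    by have := phir y 1 x x'; rewrite !scale1r.
  by have := phil x 1 y y'; rewrite !scale1r.
have glin : linear (tensor_lift phi).
  move=> a u v; rewrite tensor_liftD //; congr (_ + _).
  move: u; apply: tensor_morph_ext => [u w|u w|x y].
  - by rewrite scalerDr tensor_liftD.
  - by rewrite tensor_liftD // scalerDr.
  - by rewrite tensZl !tensor_lift_tens.
pose gM := GRing.isLinear.Build _ _ _ _ _ glin.
pose g : hom tensor Z := HB.pack (tensor_lift phi) gM.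
exists g; split=> [x y|h hE]; first exact: tensor_lift_tens.
apply: homP; apply: tensor_morph_ext => [u v|u v|x y]; rewrite ?raddfD //.
by rewrite hE; exact: tensor_lift_tens.
Qed.

End Tensor.

(* [f (x) Y : X (x) Y -> X' (x) Y] *)
Section TensorMap.
Variables (A : comPzRingType) (X X' Y : lmodType A) (f : {linear X -> X'}).

Definition tensor_map : tensor X Y -> tensor X' Y :=
  tensor_lift (fun x y => tens (f x) y).

Fact tensor_map_balanced : balanced (fun x (y : Y) => tens (f x) y).
Proof.
split=> [x x' y|x y y'|a x y]; first by rewrite linearD tensDl.
  exact: tensDr.
by rewrite linearZ tensZ.
Qed.

Lemma tensor_map_tens x y : tensor_map (tens x y) = tens (f x) y.
Proof. exact: tensor_lift_tens tensor_map_balanced _ _. Qed.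

Fact tensor_map_linear : linear tensor_map.
Proof.
have D := tensor_liftD tensor_map_balanced.
move=> a u v; rewrite [LHS]D; congr (_ + _).
move: u; apply: tensor_morph_ext => [u w|u w|x y].
- by rewrite scalerDr [LHS]D.
- by rewrite [tensor_map _]D scalerDr.
- by rewrite tensZl [LHS]tensor_map_tens tensor_map_tens tensZl linearZ.
Qed.

HB.instance Definition _ :=
  GRing.isLinear.Build A _ _ _ tensor_map tensor_map_linear.

End TensorMap.

Arguments tensor_map {A X X'} Y f.

(** * Extension and coextension of scalars *)

Section ChangeOfRings.
Variables (A B : comPzRingType) (f : {rmorphism A -> B}) (X : lmodType A).

(* [X (x)_A B], with [b] acting by multiplication on the factor [B] *)
Definition extscal : Type := tensor X (algmod f).

HB.instance Definition _ := GRing.Zmodule.copy extscal (tensor X (algmod f)).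

Definition extscal_scale (b : B) : extscal -> extscal :=
  tensor_lift (fun x (s : algmod f) => @tens A X (algmod f) x (b * (s : B))).

Fact extscal_balanced b :
  balanced (fun x (s : algmod f) => @tens A X (algmod f) x (b * (s : B))).
Proof.
split=> [x x' s|x s s'|a x s]; first exact: tensDl.
  by rewrite -tensDr; congr tens; exact: mulrDr.
by rewrite tensZ; congr tens; exact: mulrCA.
Qed.

Lemma extscal_scale_tens b x (s : algmod f) :
  extscal_scale b (tens x s) = @tens A X (algmod f) x (b * (s : B)).
Proof. exact: (tensor_lift_tens (extscal_balanced b)). Qed.

Fact extscal_scalerDr : right_distributive extscal_scale +%R.
Proof. by move=> b; exact: (tensor_liftD (extscal_balanced b)). Qed.
Fact extscal_scalerA b c u :
  extscal_scale b (extscal_scale c u) = extscal_scale (b * c) u.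
Proof.
move: u; apply: tensor_morph_ext => [u v|u v|x s].
- by rewrite !extscal_scalerDr.
- exact: extscal_scalerDr.
- by rewrite !extscal_scale_tens mulrA.
Qed.
Fact extscal_scale1r : left_id 1 extscal_scale.
Proof.
apply: tensor_morph_ext => [u v|//|x s]; first exact: extscal_scalerDr.
by rewrite extscal_scale_tens mul1r.
Qed.
Fact extscal_scalerDl u : {morph extscal_scale^~ u : b c / b + c}.
Proof.
move=> b c; move: u; apply: tensor_morph_ext => [u v|u v|x s].
- exact: extscal_scalerDr.
- by rewrite !extscal_scalerDr addrACA.
- by rewrite !extscal_scale_tens -tensDr; congr tens; exact: mulrDl.
Qed.

HB.instance Definition _ := GRing.Zmodule_isLmodule.Build B extscal
  extscal_scalerA extscal_scale1r extscal_scalerDr extscal_scalerDl.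

(* [Hom_A(B, X)], with [(b *: g) s = g (b * s)] *)
Definition coextscal : Type := hom (algmod f) X.

HB.instance Definition _ := GRing.Zmodule.copy coextscal (hom (algmod f) X).

Definition coextscal_fun (b : B) (g : hom (algmod f) X) (s : algmod f) : X :=
  g (b * s : algmod f).

Fact coextscal_fun_linear b g : linear (coextscal_fun b g).
Proof.
move=> a s t; rewrite /coextscal_fun -linearP; congr (g _).
by rewrite [LHS]mulrDr; congr (_ + _); exact: mulrCA.
Qed.

HB.instance Definition _ b g :=
  GRing.isLinear.Build A _ _ _ (coextscal_fun b g) (coextscal_fun_linear b g).

Definition coextscal_scale (b : B) (g : coextscal) : coextscal :=
  (coextscal_fun b g : {linear _ -> _}).

Fact coextscal_scalerA b c g :
  coextscal_scale b (coextscal_scale c g) = coextscal_scale (b * c) g.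
Proof.
apply: homP => s; rewrite /= /coextscal_fun /= /coextscal_fun.
by rewrite mulrA (mulrC c).
Qed.
Fact coextscal_scale1r : left_id 1 coextscal_scale.
Proof. by move=> g; apply: homP => s; rewrite /= /coextscal_fun mul1r. Qed.
Fact coextscal_scalerDr : right_distributive coextscal_scale +%R.
Proof. by move=> b g h; exact: homP. Qed.
Fact coextscal_scalerDl g : {morph coextscal_scale^~ g : b c / b + c}.
Proof.
move=> b c; apply: homP => s; rewrite /= /coextscal_fun mulrDl.
exact: (raddfD (g : hom (algmod f) X)).
Qed.

HB.instance Definition _ := GRing.Zmodule_isLmodule.Build B coextscal
  coextscal_scalerA coextscal_scale1r coextscal_scalerDr coextscal_scalerDl.

End ChangeOfRings.

(** * Exactness, projective, injective and flat modules *)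

Definition exact_pair (A : comPzRingType) (X Y Z : lmodType A)
    (g : X -> Y) (h : Y -> Z) : Prop :=
  forall y, h y = 0 <-> exists x, g x = y.

Definition surj (U V : Type) (g : U -> V) : Prop := forall v, exists u, g u = v.

Section HomMaps.
Variables (A : comPzRingType) (X Y : lmodType A) (g : {linear X -> Y}).

(* [Hom(g, Z)] and [Hom(Z, g)] *)
Definition hom_pre (Z : lmodType A) (h : hom Y Z) : hom X Z := h \o g.
Definition hom_post (Z : lmodType A) (h : hom Z X) : hom Z Y := g \o h.

End HomMaps.

Section ModuleClasses.
Variables (A : comPzRingType) (X : lmodType A).

Definition zero_module : Prop := forall x : X, x = 0.

Definition projective : Prop :=
  forall (Y Z : lmodType A) (p : {linear Y -> Z}) (g : {linear X -> Z}),
    surj p -> exists h : {linear X -> Y}, p \o h =1 g.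

Definition injective_module : Prop :=
  forall (Y Z : lmodType A) (i : {linear Y -> Z}) (g : {linear Y -> X}),
    injective i -> exists h : {linear Z -> X}, h \o i =1 g.

Definition flat : Prop :=
  forall (Y Y' Y'' : lmodType A) (g : {linear Y -> Y'}) (h : {linear Y' -> Y''}),
    exact_pair g h -> exact_pair (tensor_map X g) (tensor_map X h).

End ModuleClasses.

(** * Resolutions, projective and flat dimension, Ext *)

Record resolution (A : comPzRingType) (X : lmodType A) := Resolution {
  res_obj :> nat -> lmodType A;
  res_diff : forall n, {linear res_obj n.+1 -> res_obj n};
  res_aug : {linear res_obj 0%N -> X};
  res_exactS : forall n, exact_pair (res_diff n.+1) (res_diff n);
  res_exact0 : exact_pair (res_diff 0%N) res_aug;
  res_aug_surj : surj res_aug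
}.

Section Dimensions.
Variables (A : comPzRingType) (X : lmodType A).

Definition pd_le (n : nat) : Prop :=
  exists P : resolution X,
    (forall i, projective (P i)) /\ (forall i, (n < i)%N -> zero_module (P i)).

Definition pd_finite : Prop := exists n, pd_le n.

Definition fd_le (n : nat) : Prop :=
  exists F : resolution X,
    (forall i, flat (F i)) /\ (forall i, (n < i)%N -> zero_module (F i)).

Definition fd_finite : Prop := exists n, fd_le n.

(* [Ext^p(X, Y) = 0], where [Ext^p(X, Y)] is the [p]-th cohomology of
   [0 -> Hom(P 0, Y) -> Hom(P 1, Y) -> ...] for [P] a projective resolution
   of [X]; up to isomorphism it does not depend on [P]. *)
Definition Ext_eq0 (p : nat) (Y : lmodType A) : Prop :=
  forall P : resolution X, (forall i, projective (P i)) ->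
    match p with
    | 0 => forall h, hom_pre (res_diff P 0) h = 0 :> hom _ Y -> h = 0
    | q.+1 => exact_pair (@hom_pre _ _ _ (res_diff P q) Y)
                         (@hom_pre _ _ _ (res_diff P q.+1) Y)
    end.

End Dimensions.

(** * Gorenstein projective and Gorenstein injective modules *)

(* A complex ... -> X_1 -> X_0 -> X^0 -> X^1 -> ... is indexed by [int] with
   [X_n] in degree [n] and [X^n] in degree [- 1 - n]; thus the map
   [X_0 -> X^0] is the differential [seq_diff C 0]. *)
Record sequence (A : comPzRingType) := Sequence {
  seq_obj :> int -> lmodType A;
  seq_diff : forall i, {linear seq_obj i -> seq_obj (i - 1)}
}.

Section Gorenstein.
Variables (A : comPzRingType).

Definition acyclic (C : sequence A) : Prop :=
  forall i, exact_pair (seq_diff C i) (seq_diff C (i - 1)).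

(* exactness of [Hom(C, Q)] and of [Hom(J, C)] *)
Definition Hom_to_exact (C : sequence A) (Q : lmodType A) : Prop :=
  forall i, exact_pair (@hom_pre _ _ _ (seq_diff C (i - 1)) Q)
                       (@hom_pre _ _ _ (seq_diff C i) Q).

Definition Hom_from_exact (J : lmodType A) (C : sequence A) : Prop :=
  forall i, exact_pair (@hom_post _ _ _ (seq_diff C i) J)
                       (@hom_post _ _ _ (seq_diff C (i - 1)) J).

(* [N] is isomorphic to the image of [g]: the isomorphism is written as an
   injective map into the codomain of [g] with the same image as [g]. *)
Definition iso_image (N X Y : lmodType A) (g : {linear X -> Y}) : Prop :=
  exists2 phi : {linear N -> Y}, injective phi &
    forall y, (exists n, phi n = y) <-> (exists x, g x = y).

Definition Gorenstein_projective (N : lmodType A) : Prop :=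
  exists C : sequence A,
    [/\ acyclic C, forall i, projective (C i),
        forall Q, projective Q -> Hom_to_exact C Q
      & iso_image N (seq_diff C 0)].

Definition Gorenstein_injective (N : lmodType A) : Prop :=
  exists C : sequence A,
    [/\ acyclic C, forall i, injective_module (C i),
        forall J, injective_module J -> Hom_from_exact J C
      & iso_image N (seq_diff C 0)].

End Gorenstein.

(* Main.v *)
(* Let [C] be a complete resolution of [M]; the complexes [C (x) R] and
   [Hom(R, C)] are complete resolutions over [R = A |x E].

   For (1), the modules [X] with [C (x) X] acyclic, and those with [Hom(C, X)]
   acyclic, are closed under extensions and under quotients by members of the
   class, since the [C i] are projective.  They contain the projective modules,
   hence [E] and its direct sums as [pd E] is finite, hence [R] and its direct
   sums; a projective [R]-module is a direct summand of such a sum.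

   For (2), [Hom(F, C)] is acyclic for every flat [F], because the cycles of an
   acyclic complex of injective modules are cotorsion.  Indeed [F = P / K] with
   [P] free and [K] a directed union of finitely generated direct summands
   [N] of [P], and the modules lifting against [C] are closed under directed
   unions: by induction on the size of the directed system, such a union is the
   union of a well-ordered chain of smaller ones, and partial lifts can be
   extended along the chain (Eklof).  Then [Hom(R, C)] is acyclic because
   [fd R] is finite.  An injective [R]-module is a direct summand of
   [Hom(R, I)] with [I] injective over [A]; a finite flat resolution of [R]
   gives a finite injective coresolution of [Hom(R, I)], so [Hom(Hom(R, I), C)]
   is acyclic too. *)

From HB Require Import structures.
From mathcomp Require Import all_boot all_algebra.
From mathcomp Require Import generic_quotient ring_quotient.
From mathcomp Require Import boolp classical_sets functions cardinality.
From mathcomp Require wochoice.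
(* Last, as [classical_sets] has a notation [surj]. *)
Require Import Defs.

Set Implicit Arguments.
Unset Strict Implicit.
Unset Printing Implicit Defensive.

Import GRing.Theory Num.Theory.
Local Open Scope ring_scope.

(** * Linear maps and submodules *)

Section LinearMaps.
Variables (A : comPzRingType).
Implicit Types X Y Z : lmodType A.

Definition lin_of X Y (f : X -> Y) (fl : linear f) : {linear X -> Y} :=
  HB.pack f (GRing.isLinear.Build _ _ _ _ f fl).

Lemma factor_through_inj X Y Z (i : {linear X -> Y}) (f : {linear Z -> Y}) :
    injective i -> (forall z, exists x, i x = f z) ->
  exists g : {linear Z -> X}, forall z, i (g z) = f z.
Proof.
move=> i_inj /choice[g gE].
have gl : linear g by move=> a x y; apply: i_inj; rewrite linearP !gE linearP.
by exists (lin_of gl).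
Qed.

Lemma factor_through_surj X Y Z (p : {linear Y -> X}) (f : {linear Y -> Z}) :
    surj p -> (forall y, p y = 0 -> f y = 0) ->
  exists g : {linear X -> Z}, forall y, g (p y) = f y.
Proof.
move=> /choice[s sK] kerf.
have fE y y' : p y = p y' -> f y = f y'.
  by move=> e; apply/subr0_eq; rewrite -linearB kerf // linearB e subrr.
have gl : linear (f \o s).
  by move=> a x y /=; rewrite -linearP; apply: fE; rewrite linearP !sK.
by exists (lin_of gl) => y; apply: fE; rewrite sK.
Qed.

Definition is_submod X (N : set X) : Prop :=
  [/\ N 0, forall x y, N x -> N y -> N (x + y) & forall a x, N x -> N (a *: x)].

Lemma ker_submod X Y (f : {linear X -> Y}) : is_submod [set x | f x = 0].
Proof.
split=> /= [|x y fx fy|a x fx]; first exact: linear0.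
  by rewrite linearD fx fy addr0.
by rewrite linearZ /= fx scaler0.
Qed.

Lemma image_submod X Y (f : {linear X -> Y}) :
  is_submod [set y | exists x, f x = y].
Proof.
split=> /= [|_ _ [x <-] [y <-]|a _ [x <-]]; first by exists 0; exact: linear0.
  by exists (x + y); rewrite linearD.
by exists (a *: x); rewrite linearZ.
Qed.

End LinearMaps.

Section Submodule.
Variables (A : comPzRingType) (X : lmodType A) (N : set X).
Hypothesis subN : is_submod N.

Definition submod_pred (_ : is_submod N) : {pred X} := fun x => `[<N x>].

Fact submod_pred_closed : submod_closed (submod_pred subN).
Proof.
have [N0 ND NZ] := subN.
split=> [|a x y /asboolP Nx /asboolP Ny]; apply/asboolP => //.
by apply: ND => //; exact: NZ.
Qed.
HB.instance Definition _ :=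
  GRing.isSubmodClosed.Build A X (submod_pred subN)
    (GRing.submod_closed_semi submod_pred_closed).

Record submodule : Type :=
  Submodule { submod_val : X; _ : submod_val \in submod_pred subN }.

HB.instance Definition _ := [isSub for submod_val].
HB.instance Definition _ := [Choice of submodule by <:].
HB.instance Definition _ := [SubChoice_isSubLmodule of submodule by <:].

Definition submod_incl : {linear submodule -> X} := val.

Lemma submod_inclP (x : submodule) : N (submod_incl x).
Proof. exact/asboolP/(valP x). Qed.

Lemma submod_incl_inj : injective submod_incl.
Proof. exact: val_inj. Qed.

Lemma submod_inclK x : N x -> exists y : submodule, submod_incl y = x.
Proof. by move=> /asboolP Nx; exists (Submodule Nx). Qed.

End Submodule.

Section Lifting.
Variables (A : comPzRingType).
Implicit Types X Y Z : lmodType A.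

(** [projective] lifts along surjections only; here [p] need only reach the values of [g], so both
    maps are first corestricted to the image of [p]. *)
Lemma projective_lift X Y Z (p : {linear Y -> Z}) (g : {linear X -> Z}) :
    projective X -> (forall x, exists y, p y = g x) ->
  exists h : {linear X -> Y}, forall x, p (h x) = g x.
Proof.
move=> projX gp; pose im := submod_incl (image_submod p).
have im_inj : injective im by exact: submod_incl_inj.
have [|p' p'E] := @factor_through_inj _ _ _ _ im p im_inj.
  by move=> y; apply: submod_inclK; exists y.
have [|g' g'E] := @factor_through_inj _ _ _ _ im g im_inj.
  by move=> x; apply: submod_inclK; exact: gp.
have [|h hE] := projX _ _ p' g'.
  move=> z; have [y yE] := submod_inclP z.
  by exists y; apply: im_inj; rewrite p'E.
by exists h => x; rewrite -p'E -g'E -hE.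
Qed.

End Lifting.

(** Dimension shifting: each kernel in the resolution is the quotient of the next term by the next
    kernel, and the kernels far to the left vanish. *)
Lemma resolution_ind (A : comPzRingType) (P : lmodType A -> Prop)
    (X : lmodType A) (F : resolution X) (n : nat) :
    (forall Z, zero_module Z -> P Z) ->
    (forall (K Y Z : lmodType A) (i : {linear K -> Y}) (p : {linear Y -> Z}),
       injective i -> exact_pair i p -> surj p -> P K -> P Y -> P Z) ->
    (forall k, P (F k)) -> (forall k, (n < k)%N -> zero_module (F k)) ->
  P X.
Proof.
move=> P0 Pquot PF F0.
have step (Y Y1 Y2 : lmodType A) (d1 : {linear Y2 -> Y1})
    (d0 : {linear Y1 -> Y}) : exact_pair d1 d0 -> P Y2 ->
    P (submodule (ker_submod d1)) -> P (submodule (ker_submod d0)).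
  move=> ex PY2 Pker1.
  have [|p pE] := factor_through_inj (f := d1)
    (submod_incl_inj (subN := ker_submod d0)).
    by move=> y; apply: submod_inclK; apply/ex; exists y.
  apply: (Pquot _ _ _ (submod_incl (ker_submod d1)) p) => //.
  - move=> y; split=> [py|[x <-]].
      by apply: submod_inclK; rewrite /= -pE py linear0.
    by apply: (@submod_incl_inj _ _ _ (ker_submod d0)); rewrite pE linear0;
      exact: (submod_inclP x).
  - move=> z; have [y yE] := (ex (submod_incl _ z)).1 (submod_inclP z).
    by exists y; apply: (@submod_incl_inj _ _ _ (ker_submod d0)); rewrite pE.
have Pker k : P (submodule (ker_submod (res_diff F k))).
  (* Induction on the gap [m]: [res_diff F k] starts at [F k.+1], so its kernel is zero as soon as
     [n <= k]. *)
  have [m le_nkm] : exists m, (n <= k + m)%N by exists n; rewrite leq_addl.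
  elim: m k le_nkm => [|m IHm] k.
    rewrite addn0 -ltnS => ltnk; apply: P0 => z.
    by apply: submod_incl_inj; exact: (F0 _ ltnk).
  rewrite addnS -addSn => /IHm; apply: step; [exact: res_exactS | exact: PF].
have := step _ _ _ _ _ (@res_exact0 _ _ F) (PF _) (Pker 0%N).
move=> Paug; apply: (Pquot _ _ _ (submod_incl (ker_submod (res_aug F))) _ _ _
  (@res_aug_surj _ _ F) Paug (PF _)); first exact: submod_incl_inj.
move=> y; split=> [y0|[x <-]]; last exact: (submod_inclP x).
exact: (@submod_inclK _ _ _ (ker_submod (res_aug F))).
Qed.

(** * Direct sums of copies of a module *)

Section DirectPower.
Variables (A : comPzRingType) (I : choiceType) (X : lmodType A).

Definition finite_support : set (I -> X) :=
  [set f | exists s : seq I, forall i, i \notin s -> f i = 0].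

Fact finite_support_submod : is_submod finite_support.
Proof.
split=> [|f g [s fs] [t gt]|a f [s fs]]; first by exists [::].
  exists (s ++ t) => i; rewrite mem_cat negb_or => /andP[si ti].
  by rewrite -[LHS]/(f i + g i) fs // gt // addr0.
by exists s => i si; rewrite -[LHS]/(a *: f i) fs // scaler0.
Qed.

Definition dpow : lmodType A := submodule finite_support_submod.

Definition dcoord (i : I) (f : dpow) : X := submod_incl finite_support_submod f i.

Fact dcoord_linear i : linear (dcoord i).
Proof. by move=> a f g; rewrite /dcoord linearP. Qed.
HB.instance Definition _ i :=
  GRing.isLinear.Build A _ _ _ (dcoord i) (@dcoord_linear i).

Lemma dpowP (f g : dpow) : (forall i, dcoord i f = dcoord i g) -> f = g.
Proof. by move=> fg; apply: submod_incl_inj; apply/funext. Qed.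

Lemma dpow_of (f : I -> X) (s : seq I) : (forall i, i \notin s -> f i = 0) ->
  exists g : dpow, forall i, dcoord i g = f i.
Proof.
move=> fs; have [|g gE] := @submod_inclK _ _ _ finite_support_submod f.
  by exists s.
by exists g => i; rewrite /dcoord gE.
Qed.

Lemma dsupp_subproof (f : dpow) :
  {s : seq I | forall i, i \notin s -> dcoord i f = 0}.
Proof. exact/cid/(submod_inclP f). Qed.

(** Only a duplicate-free list containing the support: coordinates on it may vanish. *)
Definition dsupp (f : dpow) : seq I := undup (sval (dsupp_subproof f)).

Lemma dsupp_uniq f : uniq (dsupp f). Proof. exact: undup_uniq. Qed.

Lemma dsuppP f i : i \notin dsupp f -> dcoord i f = 0.
Proof. by rewrite mem_undup; exact: (svalP (dsupp_subproof f)). Qed.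

Lemma dinj_subproof (i : I) :
  {g : {linear X -> dpow} |
    forall x j, dcoord j (g x) = if j == i then x else 0}.
Proof.
apply: cid.
have /choice[g gE] (x : X) :
    exists f : dpow, forall j, dcoord j f = if j == i then x else 0.
  apply: (@dpow_of _ [:: i]) => j.
  by rewrite inE => /negPf->.
have gl : linear g.
  move=> a x y; apply: dpowP => j; rewrite linearP /= !gE.
  by case: eqP => // _; rewrite scaler0 addr0.
by exists (lin_of gl).
Qed.

Definition dinj i : {linear X -> dpow} := sval (dinj_subproof i).

Lemma dcoord_dinj i j x : dcoord j (dinj i x) = if j == i then x else 0.
Proof. exact: (svalP (dinj_subproof i)). Qed.

Lemma dpowE (f : dpow) (s : seq I) :
    uniq s -> (forall i, i \notin s -> dcoord i f = 0) ->
  f = \sum_(i <- s) dinj i (dcoord i f).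
Proof.
move=> s_uniq fs; apply: dpowP => j; rewrite linear_sum /=.
under eq_bigr do rewrite dcoord_dinj.
have [js|js] := boolP (j \in s).
  rewrite (bigD1_seq j) //= eqxx big1 ?addr0 // => i /negPf.
  by rewrite eq_sym => ->.
rewrite fs // big_seq big1 // => i si.
by case: eqP => // ji; rewrite ji si in js.
Qed.

Lemma dpow_suppE f : f = \sum_(i <- dsupp f) dinj i (dcoord i f).
Proof. by apply: dpowE; [exact: dsupp_uniq | exact: dsuppP]. Qed.

Lemma dpow_ext (Z : lmodType A) (g h : {linear dpow -> Z}) :
  (forall i x, g (dinj i x) = h (dinj i x)) -> g =1 h.
Proof.
move=> gh f; rewrite (dpow_suppE f) !linear_sum.
by apply: eq_bigr => i _; exact: gh.
Qed.

Lemma dpow_univ (Z : lmodType A) (g : I -> {linear X -> Z}) :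
  exists h : {linear dpow -> Z}, forall i x, h (dinj i x) = g i x.
Proof.
pose h (f : dpow) := \sum_(i <- dsupp f) g i (dcoord i f).
(* All duplicate-free lists containing the support give the same sum, as they agree up to order once
   zero coordinates are dropped. Linearity follows by summing over a common list. *)
have hE f s : uniq s -> (forall i, i \notin s -> dcoord i f = 0) ->
    h f = \sum_(i <- s) g i (dcoord i f).
  move=> s_uniq fs; rewrite /h.
  rewrite (bigID [pred i | dcoord i f == 0]) /= big1 ?add0r; last first.
    by move=> i /eqP->; rewrite linear0.
  rewrite [RHS](bigID [pred i | dcoord i f == 0]) /= [in RHS]big1 ?add0r;
    last by move=> i /eqP->; rewrite linear0.
  rewrite -[LHS]big_filter -[RHS]big_filter; apply: perm_big.
  apply: uniq_perm; rewrite ?filter_uniq ?dsupp_uniq // => i.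
  rewrite !mem_filter; case: eqP => //= fi.
  apply/idP/idP => _; apply: contrapT => /negP.
    by move/fs.
  by move/dsuppP.
have hl : linear h.
  move=> a f1 f2; pose s := undup (dsupp f1 ++ dsupp f2).
  have sP i : i \notin s -> dcoord i f1 = 0 /\ dcoord i f2 = 0.
    rewrite mem_undup mem_cat negb_or => /andP[].
    by move=> /dsuppP-> /dsuppP->.
  have s_uniq : uniq s by exact: undup_uniq.
  rewrite !(hE _ s) //; do ?by move=> i /sP[].
    rewrite scaler_sumr -big_split; apply: eq_bigr => i _ /=.
    by rewrite !linearP.
  by move=> i /sP[f1i f2i]; rewrite linearP /= f1i f2i scaler0 addr0.
exists (lin_of hl) => i x /=.
rewrite (hE _ [:: i]) ?big_seq1 ?dcoord_dinj ?eqxx // => j.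
by rewrite inE => /negPf ji; rewrite dcoord_dinj ji.
Qed.

Lemma dpow_projective : projective X -> projective dpow.
Proof.
move=> projX Y Z p g p_surj.
have /choice[h hE] i : exists h : {linear X -> Y}, p \o h =1 g \o dinj i.
  exact: projX.
have [k kE] := dpow_univ h; exists k.
by apply: dpow_ext => i x /=; rewrite kE; exact: hE.
Qed.

End DirectPower.

Arguments dinj {A I X} i.

Lemma regular_projective (A : comPzRingType) : projective A^o.
Proof.
move=> Y Z p g p_surj; have [y yE] := p_surj (g 1).
have hl : linear (fun a : A^o => (a : A) *: y).
  by move=> a b c; rewrite scalerDl scalerA.
exists (lin_of hl) => a /=; rewrite linearZ /= yE -linearZ.
by congr (g _); exact: mulr1.
Qed.

Section FreeModule.
Variables (A : comPzRingType) (I : choiceType).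

Definition free_mod : lmodType A := dpow I A^o.

Definition dbase (i : I) : free_mod := dinj i (1 : A^o).

Lemma free_mod_projective : projective free_mod.
Proof. by apply: dpow_projective; exact: regular_projective. Qed.

Lemma dinj_dbase i (a : A) : dinj i (a : A^o) = a *: dbase i.
Proof. by rewrite /dbase -linearZ; congr (dinj i _); rewrite -[RHS]/(a * 1) mulr1. Qed.

Lemma free_mod_ext (Z : lmodType A) (g h : {linear free_mod -> Z}) :
  (forall i, g (dbase i) = h (dbase i)) -> g =1 h.
Proof.
by move=> gh; apply: dpow_ext => i a; rewrite dinj_dbase !linearZ /= gh.
Qed.

Lemma free_mod_univ (Z : lmodType A) (z : I -> Z) :
  exists h : {linear free_mod -> Z}, forall i, h (dbase i) = z i.
Proof.
have gl i : linear (fun a : A^o => (a : A) *: z i).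
  by move=> a b c; rewrite scalerDl scalerA.
have [h hE] := dpow_univ (fun i => lin_of (gl i)).
by exists h => i; rewrite /dbase hE /= scale1r.
Qed.

Lemma free_modE (x : free_mod) (s : seq I) :
    uniq s -> (forall i, i \notin s -> dcoord i x = 0) ->
  x = \sum_(i <- s) (dcoord i x : A) *: dbase i.
Proof.
move=> s_uniq xs; rewrite {1}(dpowE s_uniq xs).
by apply: eq_bigr => i _; rewrite dinj_dbase.
Qed.

End FreeModule.

Arguments dbase {A I} i.

Section FreeCover.
Variables (A : comPzRingType) (X : lmodType A).

Lemma free_cover :
  exists p : {linear free_mod A X -> X}, forall x, p (dbase x) = x.
Proof. exact: free_mod_univ. Qed.

(** The dual basis lemma: [c] is a section of the free cover on the elements of [X], and its
    coordinates are the dual functionals. *)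
Lemma projective_dual_basis : projective X ->
  exists c : {linear X -> free_mod A X}, forall (x : X) (s : seq X),
    uniq s -> (forall i, i \notin s -> dcoord i (c x) = 0) ->
    x = \sum_(i <- s) (dcoord i (c x) : A) *: i.
Proof.
move=> projX; have [p pE] := free_cover.
have [c cE] := projX _ _ p idfun (fun x => ex_intro _ _ (pE x)).
exists c => x s s_uniq xs; rewrite -{1}[x]/(idfun x) -cE /=.
rewrite {1}(free_modE s_uniq xs) linear_sum.
by apply: eq_bigr => i _; rewrite linearZ /= pE.
Qed.

End FreeCover.

Local Open Scope classical_set_scope.

(** * Lifting against an acyclic complex of injective modules *)

Section InjectiveExtension.
Variables (A : comPzRingType).
Implicit Types X Y Z : lmodType A.

(** A partial linear map is encoded as a total function that is linear on [N], which suits functions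
    glued pointwise along a chain. *)
Lemma injective_extend_partial X (I : lmodType A) (N : set X) (v : X -> I) :
    injective_module I -> is_submod N ->
    (forall a x y, N x -> N y -> v (a *: x + y) = a *: v x + v y) ->
  exists w : {linear X -> I}, forall x, N x -> w x = v x.
Proof.
move=> injI subN vl; pose i := submod_incl subN.
have gl : linear (v \o i).
  move=> a x y; rewrite -[LHS]/(v (i (a *: x + y))) linearP.
  by rewrite vl //; exact: submod_inclP.
have [w wE] := injI _ _ i (lin_of gl) (@submod_incl_inj _ _ _ subN).
exists w => x /(submod_inclK subN)[y <-]; exact: wE.
Qed.

Lemma acyclic_diff_comp (C : sequence A) i (x : C i) :
  acyclic C -> seq_diff C (i - 1) (seq_diff C i x) = 0.
Proof. by move=> exC; apply/exC; exists x. Qed.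

End InjectiveExtension.

Section LiftsOn.
Variables (A : comPzRingType) (C : sequence A).
Hypotheses (acC : acyclic C) (injC : forall i, injective_module (C i)).
Variable X : lmodType A.

(* As the [C i] are injective, for a submodule [N] this says that [Hom(N, C)]
   is exact, without forming the module [N]. *)
Definition lifts_on (N : set X) : Prop :=
  forall i (u : {linear X -> C (i - 1)}),
    (forall x, N x -> seq_diff C (i - 1) (u x) = 0) ->
  exists v : {linear X -> C i}, forall x, N x -> seq_diff C i (v x) = u x.

(** A lift of [u] on [N'] differs from [v] on [N] by a cycle, which is there the boundary of some
    [t]; subtracting the boundary of [t] restores [v] on [N] and leaves a lift on [N']. *)
Lemma lifts_on_extend (N N' : set X) i
    (u : {linear X -> C (i - 1)}) (v : {linear X -> C i}) :
    lifts_on N -> lifts_on N' -> N `<=` N' ->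
    (forall x, N' x -> seq_diff C (i - 1) (u x) = 0) ->
    (forall x, N x -> seq_diff C i (v x) = u x) ->
  exists w : {linear X -> C i},
    (forall x, N' x -> seq_diff C i (w x) = u x) /\
    (forall x, N x -> w x = v x).
Proof.
(* Writing [i] as [i + 1 - 1] makes [C i] the target of [seq_diff C (i + 1)]. *)
move=> LN LN' NN'; move: u v; rewrite -(addrK 1 i) => u v du dv.
have [w wE] := LN' _ u du.
have [x Nx|t tE] := LN _ (w \- v : {linear X -> C (i + 1 - 1)}).
  by rewrite /= linearB /= wE ?dv ?subrr //; exact: NN'.
exists (w \- (seq_diff C (i + 1) \o t)); split=> x Nx /=.
  by rewrite linearB /= acyclic_diff_comp // subr0 wE.
by rewrite tE //= subKr.
Qed.

(* Eklof's lemma: [D] is the union of a chain of smaller members of [DD], and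
   partial lifts are extended along [DD] by Zorn's lemma. *)
Lemma lifts_on_chain (W : Type) (DD : set (set W)) (D : set W)
    (K : set W -> set X) :
    DD D -> (forall E, DD E -> E `<=` D) ->
    total_on DD subset ->
    (forall EE, EE `<=` DD -> EE !=set0 -> DD (\bigcup_(E in EE) E)) ->
    (forall E, DD E -> is_submod (K E)) ->
    (forall EE, EE `<=` DD -> EE !=set0 ->
       K (\bigcup_(E in EE) E) = \bigcup_(E in EE) K E) ->
    (forall E, DD E -> E <> D -> lifts_on (K E)) ->
    (exists2 E, DD E & E <> D) ->
    (forall x, D x -> exists E, [/\ DD E, E <> D & E x]) ->
  lifts_on (K D).
Proof.
move=> DDD DDsub DDtot DDcup Ksub Kcup KL [E0 DE0 E0D] Dcover i u du.
have Kmono E E' : DD E -> DD E' -> E `<=` E' -> K E `<=` K E'.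
  move=> DE DE' EE'; have <- : \bigcup_(F in [set E; E']) F = E'.
    by rewrite bigcup_setU !bigcup_set1; apply/setUidPr.
  rewrite Kcup; first by move=> x Kx; exists E => //; left.
    by move=> F [] ->.
  by exists E; left.
(* Zorn's lemma is applied to pairs of a stage [E] and a map that lifts [u] on [K E]; the order
   compares maps on the smaller stage only. *)
pose ok (p : set W * {linear X -> C i}) :=
  DD p.1 /\ forall x, K p.1 x -> seq_diff C i (p.2 x) = u x.
pose T := {p | ok p}.
pose R (p q : T) := `[< (sval p).1 `<=` (sval q).1 /\
  forall x, K (sval p).1 x -> (sval q).2 x = (sval p).2 x >].
have duK E x : DD E -> K E x -> seq_diff C (i - 1) (u x) = 0.
  by move=> DE Kx; apply: du; apply: (Kmono _ _ DE DDD) => //; exact: DDsub.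
have [v0 v0E] := KL _ DE0 E0D i u (fun x => duK _ x DE0).
pose t0 : T := exist _ (E0, v0) (conj DE0 v0E).
have [|r s t|F Ftot|[[E v] [DE vE]] maxp] := @ZL_preorder T t0 R.
- by move=> t; apply/asboolP; split.
- move=> /asboolP[rs rsE] /asboolP[st stE]; apply/asboolP; split.
    exact: subset_trans st.
  move=> x Kx; rewrite stE ?rsE //.
  by apply: (Kmono _ _ _ _ rs) => //; [case: (svalP r) | case: (svalP s)].
- have [[q0 Fq0]|Fnone] := pselect (exists q, F q); last first.
    by exists t0 => s Fs; case: Fnone; exists s.
  pose EE : set (set W) := [set (sval q).1 | q in F].
  have EEDD : EE `<=` DD by move=> _ [q _ <-]; case: (svalP q).
  have EEn0 : EE !=set0 by exists (sval q0).1; exists q0.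
  pose U := \bigcup_(E in EE) E.
  have DU : DD U by exact: DDcup.
  have KUE : K U = \bigcup_(E in EE) K E by exact: Kcup.
  have KU x : K U x -> exists2 q, F q & K (sval q).1 x.
    by rewrite KUE => -[_ [q Fq <-] Kx]; exists q.
  have agree (q q' : T) x : F q -> F q' -> K (sval q).1 x ->
      K (sval q').1 x -> (sval q).2 x = (sval q').2 x.
    move=> Fq Fq' Kx Kx'.
    have [/asboolP[_ h]|/asboolP[_ h]] := Ftot _ _ Fq Fq'; last exact: h.
    by rewrite h.
  have [v vE] : exists v : X -> C i, forall q x, F q -> K (sval q).1 x ->
      v x = (sval q).2 x.
    have /choice[v vE] (x : X) : exists y : C i, forall q, F q ->
        K (sval q).1 x -> y = (sval q).2 x.
      have [[q [Fq Kx]]|none] := pselect (exists q, F q /\ K (sval q).1 x).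
        by exists ((sval q).2 x) => q' Fq' Kx'; exact: agree.
      by exists 0 => q Fq Kx; case: none; exists q.
    by exists v => q x; exact: vE.
  (* The glued function is linear on [K U], since any two points there lie in one stage of the
     chain; injectivity of [C i] extends it to [X]. *)
  have [|w wE] := injective_extend_partial (@injC i) (Ksub _ DU) (v := v).
    move=> a x y /KU[q Fq Kx] /KU[q' Fq' Ky].
    have [q1 [Fq1 Kx1 Ky1]] : exists q1,
        [/\ F q1, K (sval q1).1 x & K (sval q1).1 y].
      have [/asboolP[h _]|/asboolP[h _]] := Ftot _ _ Fq Fq'.
        exists q'; split=> //; apply: (Kmono _ _ _ _ h) => //.
          by case: (svalP q).
        by case: (svalP q').
      exists q; split=> //; apply: (Kmono _ _ _ _ h) => //.
        by case: (svalP q').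
      by case: (svalP q).
    rewrite !(vE q1) ?linearP //.
    have [|_ KD KZ] := Ksub (sval q1).1; first by case: (svalP q1).
    by apply: KD => //; exact: KZ.
  have wq q x : F q -> K (sval q).1 x -> w x = (sval q).2 x.
    move=> Fq Kx; rewrite wE ?(vE q) // KUE.
    by exists (sval q).1 => //; exists q.
  have okw : ok (U, w).
    split=> //= x /KU[q Fq Kx]; rewrite (wq q) //.
    by case: (svalP q) => _; exact.
  exists (exist _ _ okw) => q Fq; apply/asboolP; split=> /=.
    by move=> x qx; exists (sval q).1 => //; exists q.
  by move=> x Kx; exact: wq.
- have [<-|ED] := pselect (E = D); first by exists v.
  (* If the maximal stage [E] is proper, a point of [D] outside it lies in a proper [E'], which
     contains [E] by totality. Both [K E] and [K E'] are liftable, so the lift extends to [E'],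
     against maximality. *)
  have [x Dx Ex] : exists2 x, D x & ~ E x.
    apply: contrapT => none; apply: ED; apply/seteqP; split.
      exact: DDsub.
    by move=> x Dx; apply: contrapT => Ex; apply: none; exists x.
  have [E' [DE' E'D E'x]] := Dcover x Dx.
  have EE' : E `<=` E'.
    by have [//|/(_ x E'x)] := DDtot _ _ DE DE'.
  have [w [wE wv]] := lifts_on_extend (KL _ DE ED) (KL _ DE' E'D)
    (Kmono _ _ DE DE' EE') (fun y => duK _ y DE') vE.
  have /asboolP[/= E'E _] := maxp (exist _ (E', w) (conj DE' wE))
    (asboolT (conj EE' wv)).
  by case: Ex; exact: E'E.
Qed.

End LiftsOn.

(** * Initial segments of a well-ordering *)

Section InitialSegments.
Variables (W : eqType) (le : rel W).
Hypothesis wo_le : wochoice.well_order le.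

Definition down_closed (E : set W) : Prop := forall x y, le y x -> E x -> E y.

Definition init_seg (c : W) : set W := [set x | le x c /\ x <> c].

Lemma wo_min (E : set W) : E !=set0 ->
  exists2 m, E m & forall x, E x -> le m x.
Proof.
move=> [x Ex]; have [|m [[Em minm] _]] := wo_le (A := [pred x | `[< E x >]]).
  by exists x; apply/asboolP.
exists m; first exact/asboolP.
by move=> y /asboolP Ey; apply: minm.
Qed.

Lemma wo_refl x : le x x.
Proof. by have [m -> ] := @wo_min [set x] (ex_intro _ x erefl); apply. Qed.

Lemma wo_total x y : le x y \/ le y x.
Proof.
have [m [->|->] h] := @wo_min [set x; y] (ex_intro _ x (or_introl erefl)).
  by left; apply: h; right.
by right; apply: h; left.
Qed.

Lemma wo_antisym x y : le x y -> le y x -> x = y.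
Proof.
move=> xy yx; have [|m [_ um]] := wo_le (A := [pred z | (z == x) || (z == y)]).
  by exists x; rewrite inE eqxx.
have <- : m = x.
  apply: um; split; first by rewrite inE eqxx.
  by move=> z /orP[/eqP->|/eqP->]; rewrite ?wo_refl.
apply: um; split; first by rewrite inE eqxx orbT.
by move=> z /orP[/eqP->|/eqP->]; rewrite ?wo_refl.
Qed.

Lemma wo_trans x y z : le x y -> le y z -> le x z.
Proof.
move=> xy yz.
have [m [[->|->]|->] h] := @wo_min ([set x; y] `|` [set z])
    (ex_intro _ x (or_introl (or_introl erefl))).
- by apply: h; right.
- have -> // : x = y by apply: wo_antisym => //; apply: h; left; left.
have zy : z = y by apply: wo_antisym => //; apply: h; left; right.
by rewrite zy.
Qed.

Lemma init_seg_down_closed c : down_closed (init_seg c).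
Proof.
move=> x y yx [xc xnc]; split; first exact: wo_trans xc.
by move=> yc; apply: xnc; apply: wo_antisym; rewrite // -yc.
Qed.

Lemma down_closed_total E E' : down_closed E -> down_closed E' ->
  E `<=` E' \/ E' `<=` E.
Proof.
move=> dE dE'; have [EE'|/existsNP[x /not_implyP[Ex E'x]]] := pselect (E `<=` E').
  by left.
right=> y E'y; have [xy|yx] := wo_total x y; last exact: dE Ex.
by case: E'x; exact: dE' E'y.
Qed.

Lemma proper_down_closedE D E : down_closed D -> down_closed E ->
  E `<=` D -> E <> D -> exists2 c, D c & E = init_seg c.
Proof.
move=> dD dE ED EnD; have [|c [Dc Ec] minc] := @wo_min (D `\` E).
  apply: contrapT => none; apply: EnD; apply/seteqP; split=> // x Dx.
  by apply: contrapT => Ex; apply: none; exists x.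
exists c => //; apply/seteqP; split=> x.
  move=> Ex; have xc : x <> c by move=> xc; rewrite -xc in Ec.
  split=> //; have [//|cx] := wo_total x c.
  by case: Ec; exact: dE Ex.
move=> [xc xnc]; apply: contrapT => Ex; apply: xnc; apply: wo_antisym => //.
by apply: minc; split=> //; exact: dD Dc.
Qed.

(** Proper down-closed subsets have the form [init_seg c]. A least counterexample [c] settles these
    first, and one more step gives any [D]. *)
Lemma down_closed_ind (P : set W -> Prop) :
    (forall D, down_closed D ->
       (forall E, down_closed E -> E `<=` D -> E <> D -> P E) -> P D) ->
  forall D, down_closed D -> P D.
Proof.
move=> step.
have Pinit c : P (init_seg c).
  apply: contrapT => nPc.
  have [m nPm minm] := @wo_min [set c | ~ P (init_seg c)] (ex_intro _ c nPc).
  apply: nPm; apply: step (@init_seg_down_closed _) _ => E dE EI EnI.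
  have [c' [c'm c'nm] ->] :=
    proper_down_closedE (@init_seg_down_closed _) dE EI EnI.
  apply: contrapT => nPc'; apply: c'nm; apply: wo_antisym => //.
  exact: minm.
move=> D dD; apply: step => // E dE ED EnD.
by have [c _ ->] := proper_down_closedE dD dE ED EnD.
Qed.

End InitialSegments.

(** When [j] chooses upper bounds in a directed family, the closure of [S] indexes a directed
    subfamily. *)
Inductive op_closure (T : Type) (j : T -> T -> T) (S : set T) : T -> Prop :=
| op_closure_base a of S a : op_closure j S a
| op_closure_op a b of op_closure j S a & op_closure j S b :
    op_closure j S (j a b).

Lemma op_closure_mono (T : Type) (j : T -> T -> T) (S S' : set T) :
  S `<=` S' -> op_closure j S `<=` op_closure j S'.
Proof.
move=> SS' a; elim=> [b Sb|b c _ IHb _ IHc]; last exact: op_closure_op.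
by apply: op_closure_base; exact: SS'.
Qed.

(** Members of the closure are values of binary trees with numbers at the leaves, and such trees are
    countable. Malformed trees get the value [h 0], which lies in the closure. *)
Lemma op_closure_countable (T : Type) (j : T -> T -> T) (h : nat -> T) :
  exists e : nat -> T, op_closure j (range h) = range e.
Proof.
pose ev := fix ev (t : GenTree.tree nat) : T := match t with
  | GenTree.Leaf n => h n
  | GenTree.Node _ [:: l; r] => j (ev l) (ev r)
  | _ => h 0%N
  end.
pose e n := if unpickle n is Some t then ev t else h 0%N.
exists e; apply/seteqP; split=> a.
  elim=> {a} [a [n _ <-]|a b _ [n _ <-] _ [m _ <-]].
    by exists (pickle (GenTree.Leaf n)) => //; rewrite /e pickleK.
  pose tr n := if unpickle n is Some t then t else GenTree.Leaf 0%N.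
  have eE k : e k = ev (tr k) by rewrite /e /tr; case: unpickle.
  exists (pickle (GenTree.Node 0%N [:: tr n; tr m])) => //.
  by rewrite {1}/e pickleK /= -!eE.
have base n : op_closure j (range h) (h n) by apply: op_closure_base; exists n.
have evP : forall t, op_closure j (range h) (ev t).
  fix IH 1 => -[n|k [|l [|r [|? ?]]]] //=.
  by apply: op_closure_op; exact: IH.
by move=> [n _ <-]; rewrite /e; case: unpickle => [t|].
Qed.

(** Hilbert's hotel: along an injection [f] of the naturals into [D], the values of [g] move one
    place up, which frees [f 0] for the value at [m]. *)
Lemma infinite_absorb (T R : Type) (g : T -> R) (D : set T) (m : T) :
    infinite_set D ->
  exists g' : T -> R, g' @` D = g @` (D `|` [set m]).
Proof.
elim/Ppointed: T => T in g D m *; first by case: (no m).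
move=> /infiniteP/pcard_leP/injfunPex [f fD f_inj].
have {}f_inj : injective f by move=> x y; apply: f_inj; rewrite inE.
have {}fD n : D (f n) by exact: fD.
exists (fun x => if pselect (exists n, x = f n) is left e then
    (if sval (cid e) is n.+1 then g (f n) else g m) else g x).
have E n : (if pselect (exists k, f n = f k) is left e then
    (if sval (cid e) is k.+1 then g (f k) else g m) else g (f n)) =
    if n is k.+1 then g (f k) else g m.
  case: pselect => [e|[]]; last by exists n.
  by rewrite -(f_inj _ _ (svalP (cid e))).
apply/seteqP; split=> _ [x Dx <-].
  case: pselect => [e|_]; last by exists x => //; left.
  case: (sval (cid e)) => [|n]; first by exists m => //; right.
  by exists (f n) => //; left.
case: Dx => [Dx|->]; last by exists (f 0%N) => //; rewrite E.
have [[n xn]|xnf] := pselect (exists n, x = f n).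
  by exists (f n.+1) => //; rewrite E -xn.
by exists x => //; case: pselect.
Qed.

Section DirectedUnion.
Variables (A : comPzRingType) (C : sequence A).
Hypotheses (acC : acyclic C) (injC : forall i, injective_module (C i)).
Variable X : lmodType A.
Variables (Ix : eqType) (N : Ix -> set X) (j : Ix -> Ix -> Ix).
Hypotheses (subN : forall a, is_submod (N a))
  (liftN : forall a, lifts_on C (N a))
  (jl : forall a b, N a `<=` N (j a b)) (jr : forall a b, N b `<=` N (j a b)).

(** The union of the directed subfamily generated by [S]; the clause [x = 0] keeps it a submodule
    when [S] is empty. *)
Let K (S : set Ix) : set X :=
  [set x | x = 0 \/ exists2 a, op_closure j S a & N a x].

Let K_submod S : is_submod (K S).
Proof.
split=> [|x y|a x]; first by left.
  case=> [->|[a Sa ax]]; first by rewrite add0r.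
  case=> [->|[b Sb byy]]; first by rewrite addr0; right; exists a.
  right; exists (j a b); first exact: op_closure_op.
  by have [_ ND _] := subN (j a b); apply: ND; [exact: jl | exact: jr].
case=> [->|[b Sb bx]]; first by left; rewrite scaler0.
by right; exists b => //; have [_ _ NZ] := subN b; exact: NZ.
Qed.


Let lifts_on_set0 : lifts_on C [set (0 : X)].
Proof.
move=> i u _; exists (\0 : {linear X -> C i}) => x ->.
by rewrite !linear0.
Qed.

(** Eklof's lemma along the down-closed sets of naturals: a proper one is empty and contributes [0],
    or has a last element [m] and contributes [N (c m)]. *)
Let lifts_on_nat_chain (c : nat -> Ix) : (forall n, N (c n) `<=` N (c n.+1)) ->
  lifts_on C [set x | x = 0 \/ exists n, N (c n) x].
Proof.
move=> cS; pose K' (E : set nat) : set X :=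
  [set x | x = 0 \/ exists2 n, E n & N (c n) x].
have cmono m n : (m <= n)%N -> N (c m) `<=` N (c n).
  move=> /subnK <-; elim: (n - m)%N => [|k IHk] //=.
  exact: subset_trans (cS _).
have -> : [set x | x = 0 \/ exists n, N (c n) x] = K' [set: nat].
  apply/seteqP; split=> x /= [->|]; do ?by left.
    by move=> [n nx]; right; exists n.
  by move=> [n _ nx]; right; exists n.
pose DD : set (set nat) := [set E | forall m n, (m <= n)%N -> E n -> E m].
apply: (lifts_on_chain acC injC (DD := DD)) => //.
- move=> E E' dE dE'.
  have [EE'|/existsNP[x /not_implyP[Ex E'x]]] := pselect (E `<=` E').
    by left.
  right=> y E'y; have [xy|/ltnW yx] := leqP x y; last exact: dE Ex.
  by case: E'x; exact: dE' E'y.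
- move=> EE EED _ m n mn [E EEE En]; exists E => //.
  exact: (EED _ EEE) En.
- move=> E _; split=> [|x y|a x]; first by left.
    case=> [->|[m Em mx]]; first by rewrite add0r.
    case=> [->|[n En ny]]; first by rewrite addr0; right; exists m.
    right; have [_ ND _] := subN (c (maxn m n)).
    exists (maxn m n); first by case: (leqP m n).
    by apply: ND; [move: mx | move: ny]; apply: cmono;
      rewrite ?leq_maxl ?leq_maxr.
  case=> [->|[n En nx]]; first by left; rewrite scaler0.
  by right; exists n => //; have [_ _ NZ] := subN (c n); exact: NZ.
- move=> EE _ [E0 EE0]; apply/seteqP; split=> x.
    case=> [->|[n [E EEE En] nx]]; first by exists E0 => //; left.
    by exists E => //; right; exists n.
  move=> [E EEE [->|[n En nx]]]; first by left.
  by right; exists n => //; exists E.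
- move=> E dE EnT.
  have exn : exists n, `[< ~ E n >].
    apply: contrapT => none; apply: EnT; apply/seteqP; split=> // n _.
    by apply: contrapT => En; apply: none; exists n; apply/asboolP.
  case: (ex_minnP exn) => -[|m] /asboolP Em minm.
    rewrite (_ : K' E = [set 0]); first exact: lifts_on_set0.
    apply/seteqP; split=> x; last by left.
    by case=> // -[n En _]; case: Em; exact: dE En.
  have EM : E m by apply: contrapT => /asboolP/minm; rewrite ltnn.
  rewrite (_ : K' E = N (c m)); first exact: liftN.
  apply/seteqP; split=> x; last by move=> mx; right; exists m.
  case=> [->|[n En]]; first by case: (subN (c m)).
  apply: cmono; rewrite leqNgt; apply/negP => mn; apply: Em; exact: dE En.
- exists set0; first by move=> m n.
  by move=> e; have : [set: nat] 0%N by []; rewrite -e.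
- move=> n _; exists `I_n.+1; split=> //=.
    by move=> m k mk /=; exact: leq_ltn_trans.
  by move=> e; have : [set: nat] n.+1 by []; rewrite -e /= ltnn.
Qed.

(** From an enumeration [e] of the closure, the successive upper bounds [c n] of [e 0], ..., [e n]
    give an increasing sequence of modules with the same union. *)
Let K_countable S : countable S -> lifts_on C (K S).
Proof.
move=> /pfcard_geP[->|/surjfunPex[h ->]].
  rewrite (_ : K set0 = [set 0]); first exact: lifts_on_set0.
  apply/seteqP; split=> x; last by left.
  by case=> // -[a + _]; elim.
have [e eE] := op_closure_countable j h.
pose c := fix c n := if n is n.+1 then j (c n) (e n.+1) else e 0%N.
have ce n : N (e n) `<=` N (c n) by case: n => //= n; exact: jr.
have cS n : op_closure j (range h) (c n).
  have eS k : op_closure j (range h) (e k) by rewrite eE; exists k.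
  by elim: n => //= n IHn; exact: op_closure_op.
rewrite (_ : K (range h) = [set x | x = 0 \/ exists n, N (c n) x]).
  by apply: lifts_on_nat_chain => n; exact: jl.
apply/seteqP; split=> x.
  case=> [->|[a]]; [by left | rewrite eE => -[n _ <-] nx].
  by right; exists n; exact: ce.
by case=> [->|[n nx]]; [left | right; exists (c n)].
Qed.

(* Induction on the initial segment [D] of a well-ordering of [Ix], over all
   [g]: a maximal element of an infinite [D] is absorbed into [g], so the
   initial segments below [D] exhaust it and Eklof's lemma applies. *)
Lemma lifts_on_directed_union : lifts_on C [set x | x = 0 \/ exists a, N a x].
Proof.
have [le wo_le] := wochoice.well_ordering_principle Ix.
suff main : forall D, down_closed le D ->
    forall g : Ix -> Ix, lifts_on C (K (g @` D)).
  have := main setT (fun _ _ _ _ => I) idfun.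
  rewrite image_id (_ : K setT = [set x | x = 0 \/ exists a, N a x]) //.
  apply/seteqP; split=> x; case=> [->|]; do ?by left.
    by move=> [a _ ax]; right; exists a.
  by move=> [a ax]; right; exists a => //; exact: op_closure_base.
apply: (down_closed_ind wo_le) => D dD IH g.
have [cD|ncD] := pselect (countable D).
  by apply: K_countable; exact: card_le_trans (card_image_le _ _) cD.
have [[m Dm maxm]|nomax] := pselect (exists2 m, D m & forall x, D x -> le x m).
  have DE : D = init_seg le m `|` [set m].
    apply/seteqP; split=> x; last first.
      by case=> [[xm _]|->] //; exact: dD Dm.
    by move=> Dx; have [->|xm] := eqVneq x m; [right | left; split;
      [exact: maxm | exact/eqP]].
  have [|g' g'E] := @infinite_absorb _ _ g (init_seg le m) m.
    move=> fin; apply: ncD; rewrite DE; apply: finite_set_countable.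
    by rewrite finite_setU.
  rewrite DE -g'E; apply: IH; first exact: init_seg_down_closed.
    by rewrite DE; exact: subsetUl.
  by move=> e; move: Dm; rewrite -e => -[].
pose DD : set (set Ix) := [set E | down_closed le E /\ E `<=` D].
apply: (lifts_on_chain acC injC (DD := DD) (K := fun E => K (g @` E))).
- by split.
- by move=> E [].
- by move=> E E' [dE _] [dE' _]; exact: (down_closed_total wo_le).
- move=> EE EED _; split=> [x y yx [E EEE Ex]|x [E EEE Ex]].
    by exists E => //; have [dE _] := EED _ EEE; exact: dE Ex.
  by have [_] := EED _ EEE; exact.
- by move=> E _; exact: K_submod.
- move=> EE EED [E0 EE0].
  have incl E a : EE E -> op_closure j (g @` E) a ->
      op_closure j (g @` \bigcup_(E in EE) E) a.
    move=> EEE; apply: op_closure_mono => _ [x Ex <-].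
    by exists x => //; exists E.
  apply/seteqP; split=> x; last first.
    move=> [E EEE [->|[a Sa ax]]]; first by left.
    by right; exists a => //; exact: incl Sa.
  case=> [->|[a Sa ax]]; first by exists E0 => //; left.
  suff [E EEE Ea] : exists2 E, EE E & op_closure j (g @` E) a.
    by exists E => //; right; exists a.
  elim: Sa => [_ [b [E EEE Eb] <-]|b c _ [E EEE Eb] _ [E' EEE' Ec]].
    by exists E => //; apply: op_closure_base; exists b.
  have [dE _] := EED _ EEE; have [dE' _] := EED _ EEE'.
  have [EE'|EE'] := down_closed_total wo_le dE dE'.
    exists E' => //; apply: op_closure_op => //.
    by apply: op_closure_mono Eb; exact: image_subset.
  exists E => //; apply: op_closure_op => //.
  by apply: op_closure_mono Ec; exact: image_subset.
- by move=> E [dE ED] EnD; exact: IH.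
- exists set0; first by split=> [x y|x].
  by move=> e; apply: ncD; rewrite -e; exact: countable0.
- move=> x Dx.
  (* As [D] has no greatest element, the segment of all [y] with [le y x] misses some [z] in [D] and
     is proper. *)
  have [z Dz zx] : exists2 z, D z & ~ le z x.
    apply: contrapT => none; apply: nomax; exists x => // z Dz.
    by apply: contrapT => zx; apply: none; exists z.
  exists [set y | le y x]; split.
  + split=> [y y' y'y yx|y yx]; first exact: (wo_trans wo_le) yx.
    exact: dD Dx.
  + by move=> e; apply: zx; rewrite -e in Dz.
  + exact: wo_refl.
Qed.

End DirectedUnion.

(** * Flat modules *)

Section TensorFacts.
Variables (A : comPzRingType) (X Y : lmodType A).

Lemma tens0r (x : X) : tens x (0 : Y) = 0.
Proof. by rewrite -(scale0r 0) -tensZr scale0r. Qed.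

Lemma tens_sumr (I : Type) (s : seq I) (x : X) (f : I -> Y) :
  tens x (\sum_(i <- s) f i) = \sum_(i <- s) tens x (f i).
Proof.
elim/big_rec2: _ => [|i y w _ <-]; [exact: tens0r | exact: tensDr].
Qed.

Lemma tens_suml (I : Type) (s : seq I) (f : I -> X) (y : Y) :
  tens (\sum_(i <- s) f i) y = \sum_(i <- s) tens (f i) y.
Proof.
elim/big_rec2: _ => [|i x w _ <-]; [exact: tens0l | exact: tensDl].
Qed.

Lemma tensorE (w : tensor X Y) :
  w = \sum_(q <- tensor_repr w) tens q.1 q.2.
Proof. by rewrite -tensor_sumE tensor_reprK. Qed.

Lemma tensor_eval (f : {linear X -> A^o}) :
  exists g : {linear tensor X Y -> Y},
    forall x y, g (tens x y) = (f x : A) *: y.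
Proof.
have [x|y|g [gE _]] := @tensor_universal A X Y Y (fun x y => (f x : A) *: y).
- by move=> a y z; rewrite scalerDr !scalerA mulrC.
- by move=> a x z; rewrite linearP scalerDl scalerA.
- by exists g.
Qed.

End TensorFacts.

(** * The equational criterion for flatness *)

Section EquationalCriterion.
Variables (A : comPzRingType) (F : lmodType A).

(** Flatness keeps exact the kernel of the transpose of the matrix with rows [L]. The tensor that
    represents [p] then comes from this kernel tensored with [F], and an expansion there is the
    factorization. *)
Lemma flat_factor (I : finType) (p : {linear free_mod A I -> F})
    (L : seq (free_mod A I)) : flat F -> (forall l, l \in L -> p l = 0) ->
  exists m (phi : 'I_m -> {linear free_mod A I -> A^o}) (y : 'I_m -> F),
    (forall k l, l \in L -> phi k l = 0) /\
    (forall x, p x = \sum_k (phi k x : A) *: y k).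
Proof.
move=> flatF pL.
have free_sum (x : free_mod A I) : x = \sum_i (dcoord i x : A) *: dbase i.
  rewrite {1}(@free_modE _ _ x (index_enum I)) ?index_enum_uniq // => i.
  by rewrite mem_index_enum.
pose l (j : 'I_(size L)) := nth 0 L j.
have pl j : p (l j) = 0 by apply: pL; rewrite mem_nth.
(* [g] takes the dot products with the [l j]. *)
have [g gE] :=
  free_mod_univ (fun i => \sum_(j < size L) (dcoord i (l j) : A) *: dbase j).
have gcoord y j :
    dcoord j (g y) = \sum_i (dcoord i y : A) * (dcoord i (l j) : A) :> A.
  rewrite {1}(free_sum y) !linear_sum; apply: eq_bigr => i _.
  rewrite !linearZ /= gE linear_sum /= (bigD1 j) //= big1 => [|j' /negPf jj'].
    rewrite linearZ /= dcoord_dinj eqxx addr0; congr (_ * _); exact: mulr1.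
  by rewrite linearZ /= dcoord_dinj eq_sym jj' scaler0.
(* [w] is the tensor that represents [p]; applying [g] to its first factors gives the sum of the
   [tens (dbase j) (p (l j))], which is zero. *)
pose w : tensor (free_mod A I) F := \sum_i tens (dbase i) (p (dbase i)).
have exg : exact_pair (submod_incl (ker_submod g)) g.
  move=> x; split=> [gx|[y <-]]; last exact: (submod_inclP y).
  exact: (@submod_inclK _ _ _ (ker_submod g)).
have [w' w'E] : exists w', tensor_map F (submod_incl (ker_submod g)) w' = w.
  apply/(flatF _ _ _ _ _ exg); rewrite linear_sum /=.
  transitivity (\sum_(j < size L) tens (dbase j) (p (l j)) :
      tensor (free_mod A 'I_(size L)) F); last first.
    by apply: big1 => j _; rewrite pl tens0r.
  under eq_bigr do rewrite tensor_map_tens gE tens_suml.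
  rewrite exchange_big; apply: eq_bigr => j _ /=.
  rewrite [in RHS](free_sum (l j)) linear_sum tens_sumr.
  by apply: eq_bigr => i _; rewrite linearZ tensZ.
pose s := tensor_repr w'; exists (size s).
(* [w] is a sum of tensors whose first factors [kap k] lie in the kernel of [g]. The functional
   [phi k] is the dot product with [kap k], so it kills each [l j]. *)
pose kap (k : 'I_(size s)) : free_mod A I :=
  submod_incl _ (tnth (in_tuple s) k).1.
have phil (k : 'I_(size s)) : linear (fun x : free_mod A I =>
    \sum_i (dcoord i x : A) * (dcoord i (kap k) : A) : A^o).
  move=> a x y; rewrite scaler_sumr -big_split; apply: eq_bigr => i _ /=.
  by rewrite linearP /= mulrDl -mulrA.
exists (fun k => lin_of (phil k)), (fun k => (tnth (in_tuple s) k).2).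
split=> [k x xL|x].
  have gk : g (kap k) = 0 by exact: (submod_inclP (tnth (in_tuple s) k).1).
  have [j <-] : exists j, l j = x.
    have xs : (index x L < size L)%N by rewrite index_mem.
    by exists (Ordinal xs); rewrite /l /= nth_index.
  transitivity (dcoord j (g (kap k))); last by rewrite gk linear0.
  rewrite gcoord; apply: eq_bigr => i _; exact: mulrC.
have pE i : p (dbase i) =
    \sum_k (dcoord i (kap k) : A) *: (tnth (in_tuple s) k).2.
  have [h hE] := tensor_eval F (dcoord i : {linear free_mod A I -> A^o}).
  have : h w = p (dbase i).
    rewrite linear_sum (bigD1 i) //= big1 => [|i' /negPf i'i].
      by rewrite hE /= dcoord_dinj eqxx scale1r addr0.
    by rewrite hE /= dcoord_dinj eq_sym i'i scale0r.
  have wE : w = \sum_(q <- s) tens (submod_incl (ker_submod g) q.1) q.2.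
    rewrite -w'E -[w' in LHS]tensor_reprK tensor_sumE linear_sum.
    by apply: eq_bigr => q _; exact: tensor_map_tens.
  rewrite wE linear_sum big_tnth => <-.
  by apply: eq_bigr => k _; rewrite hE.
rewrite {1}(free_sum x) linear_sum.
under eq_bigr do rewrite linearZ /= pE scaler_sumr.
rewrite exchange_big; apply: eq_bigr => k _ /=; rewrite scaler_suml.
by apply: eq_bigr => i _; rewrite scalerA.
Qed.

End EquationalCriterion.

Section FlatCover.
Variables (A : comPzRingType) (F : lmodType A).
Let B : choiceType := (F * nat)%type.
Let P : lmodType A := free_mod A B.
Variable p : {linear P -> F}.
Hypothesis pE : forall b : B, p (dbase b) = b.1.

(* The second components of [B] provide a preimage [dbase (y, n)] of [y]
   outside any given finite subset of the basis. *)
Definition flat_idempotent (rho : {linear P -> P}) : Prop :=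
  [/\ forall x, rho (rho x) = rho x, forall x, p (rho x) = 0
    & exists V : seq B, forall b, b \notin V -> rho (dbase b) = 0].

(** On the span of a finite part [V] of the basis, [p] factors through functionals [phi k] killing
    [L] and elements [y k]. Basis vectors over the [y k], taken outside [V], lift this to [P]; the
    projection onto the span minus that lift is the idempotent. *)
Lemma flat_idempotent_exists (L : seq P) : flat F ->
    (forall l, l \in L -> p l = 0) ->
  exists2 rho, flat_idempotent rho & forall l, l \in L -> rho l = l.
Proof.
move=> flatF pL; pose V := flatten [seq dsupp l | l <- L].
have LV l b : l \in L -> b \notin V -> dcoord b l = 0.
  move=> lL bV; apply: dsuppP; apply: contra bV => bl.
  by apply/flattenP; exists (dsupp l) => //; exact: map_f.
have [iota iotaE] := free_mod_univ (fun v : seq_sub V => dbase (val v) : P).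
have [pi piE] := free_mod_univ (fun b : B =>
  (if insub b is Some v then dbase v else 0) : free_mod A (seq_sub V)).
have piK x : pi (iota x) = x.
  have : pi \o iota =1 idfun; last by apply.
  by apply: free_mod_ext => v /=; rewrite iotaE piE valK.
have iotaK l : l \in L -> iota (pi l) = l.
  move=> lL.
  have lE : l = \sum_(b <- undup V) (dcoord b l : A) *: dbase b.
    apply: free_modE => [|b]; first exact: undup_uniq.
    by rewrite mem_undup; exact: LV.
  rewrite {1}lE [RHS]lE !linear_sum big_seq [RHS]big_seq; apply: eq_bigr => b.
  rewrite mem_undup => bV; rewrite !linearZ /= piE; congr (_ *: _).
  by rewrite insubT /= iotaE.
have [|m [phi [y [phiL phiE]]]] :=
  flat_factor (p := p \o iota) (L := [seq pi l | l <- L]) flatF.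
  by move=> _ /mapP[l lL ->] /=; rewrite iotaK // pL.
(* [n] exceeds every second component in [V]. *)
have [n nV] : exists n, forall y : F, (y, n) \notin V.
  exists (\max_(b <- V) b.2).+1 => y0; apply/negP => y0V.
  by have := @leq_bigmax_seq B V xpredT (fun b => b.2) _ y0V isT; rewrite /= ltnn.
pose tau x : P := iota (pi x) - \sum_k (phi k (pi x) : A) *: dbase (y k, n).
have taul : linear tau.
  pose sg x : P := \sum_k (phi k (pi x) : A) *: dbase (y k, n).
  have sgP a u v : sg (a *: u + v) = a *: sg u + sg v.
    rewrite scaler_sumr -big_split; apply: eq_bigr => k _ /=.
    by rewrite !linearP scalerDl scalerA.
  move=> a u v; rewrite /tau -!/(sg _) sgP linearP linearP.
  by rewrite scalerBr opprD addrACA.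
(* [pi] kills the vectors [dbase (y k, n)], so [tau] does not change [pi]; as [tau x] depends on
   [pi x] only, [tau] is idempotent. *)
have pi_tau x : pi (tau x) = pi x.
  rewrite /tau linearB piK linear_sum big1 ?subr0 // => k _.
  rewrite linearZ /= piE insubF ?scaler0 //.
  exact/negbTE.
exists (lin_of taul); last first.
  move=> l lL; rewrite /= /tau iotaK // big1 ?subr0 // => k _.
  by rewrite phiL ?scale0r //; exact: map_f.
split=> [x|x|] /=.
- by rewrite /tau -/(tau x) pi_tau.
- rewrite /tau linearB -[p (iota _)]/((p \o iota) (pi x)) phiE linear_sum.
  by apply/subr0_eq; rewrite -sumrB subr0 big1 // => k _;
    rewrite linearZ /= pE subrr.
- exists V => b bV.
  have pib : pi (dbase b) = 0 by rewrite piE insubF //; exact/negbTE.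
  rewrite /tau pib linear0 sub0r big1 ?oppr0 // => k _.
  by rewrite linear0 scale0r.
Qed.

End FlatCover.

(** * Modules that lift against a complex *)

Section LiftableModules.
Variables (A : comPzRingType) (C : sequence A).

Definition liftable (X : lmodType A) : Prop := lifts_on C [set: X].

Lemma liftableP (X : lmodType A) : acyclic C ->
  liftable X <-> Hom_from_exact X C.
Proof.
move=> acC; split=> [LX i h|LX i u du].
  split=> [dh|[v <-]].
    have [|v vE] := LX i h; last by exists v; apply: homP => x; exact: vE.
    by move=> x _; exact: (congr1 (fun f : hom _ _ => f x) dh).
  by apply: homP => x; exact: acyclic_diff_comp.
have [h _] := LX i u.
have [|v vE] := h; first by apply: homP => x; exact: du.
by exists v => x _; exact: (congr1 (fun f : hom _ _ => f x) vE).
Qed.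

Lemma zero_liftable (X : lmodType A) : zero_module X -> liftable X.
Proof.
move=> X0 i u _; exists (\0 : {linear X -> C i}) => x _.
by rewrite (X0 x) !linear0.
Qed.

Lemma liftable_retract (X Y : lmodType A) (s : {linear X -> Y})
    (r : {linear Y -> X}) :
  (forall x, r (s x) = x) -> liftable Y -> liftable X.
Proof.
move=> sK LY i u du.
have [y _|v vE] := LY i (u \o r); first exact: du.
by exists (v \o s) => x _ /=; rewrite vE //= sK.
Qed.

Lemma projective_liftable (X : lmodType A) :
  acyclic C -> projective X -> liftable X.
Proof.
move=> acC projX i u du.
have [x|v vE] := projective_lift (p := seq_diff C i) (g := u) projX.
  by apply/acC; exact: du.
by exists v.
Qed.

Hypotheses (acC : acyclic C) (injC : forall i, injective_module (C i)).

(** A lift [v] of [u \o p] is a cycle on the kernel of [p], hence a boundary there; subtracting that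
    boundary leaves a map that factors through [p]. *)
Lemma liftable_quot_on (X Y : lmodType A) (p : {linear Y -> X}) :
  surj p -> liftable Y -> lifts_on C [set y | p y = 0] -> liftable X.
Proof.
move=> p_surj LY LK i; rewrite -(addrK 1 i) => u du.
have [y _|v vE] := LY _ (u \o p); first exact: du.
have [y py|t tE] := LK _ v; first by rewrite vE //= py linear0.
have [y py|w wE] := factor_through_surj (p := p)
  (f := (v \- (seq_diff C (i + 1) \o t))) p_surj.
  by rewrite /= tE // subrr.
exists w => x _; have [y <-] := p_surj x.
by rewrite wE /= linearB /= acyclic_diff_comp // subr0 vE.
Qed.

Lemma liftable_quot (K X Y : lmodType A) (i : {linear K -> Y})
    (p : {linear Y -> X}) :
    injective i -> exact_pair i p -> surj p -> liftable K -> liftable Y ->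
  liftable X.
Proof.
move=> i_inj exip p_surj LK LY; apply: (liftable_quot_on p_surj LY) => k u du.
have [z _|v vE] := LK k (u \o i); first by apply: du; apply/exip; exists z.
have [w wE] := @injC _ _ _ _ v i_inj.
exists w => y /exip[z <-]; have /= -> := wE z; exact: vE.
Qed.

(** [u] extends to [u'] on [Y], whose boundary factors through [X] as a cycle [w]. Lifting [w] to
    [z] and subtracting [z \o p] turns [u'] into a cycle on [Y] without changing it on [K]. *)
Lemma liftable_sub (K X Y : lmodType A) (i : {linear K -> Y})
    (p : {linear Y -> X}) :
    injective i -> exact_pair i p -> surj p -> liftable Y -> liftable X ->
  liftable K.
Proof.
move=> i_inj exip p_surj LY LX k u du.
have [u' u'E] := @injC _ _ _ _ u i_inj.
have [y py|w wE] := factor_through_surj (p := p)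
    (f := (seq_diff C (k - 1) \o u')) p_surj.
  have /exip[z <-] := py; have /= -> := u'E z; exact: du.
have [x _|z zE] := LX _ w.
  by have [y <-] := p_surj x; rewrite wE acyclic_diff_comp.
have [y _|v vE] := LY k (u' \- (z \o p)).
  by rewrite /= linearB /= zE // wE subrr.
exists (v \o i) => x _ /=; rewrite vE //=.
rewrite (exip (i x)).2; last by exists x.
by rewrite linear0 subr0; exact: u'E.
Qed.

(* Bazzoni, Cortes-Izurdiaga and Estrada, and Stovicek: the cycles of an
   acyclic complex of injective modules are cotorsion. *)
Lemma flat_liftable (F : lmodType A) : flat F -> liftable F.
Proof.
move=> flatF.
have [p pE] := free_mod_univ (fun b : F * nat => b.1).
pose Ix := {rho | flat_idempotent p rho}.
pose N (a : Ix) : set (free_mod A (F * nat)%type) :=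
  [set x | exists y, sval a y = x].
have Nfix (a : Ix) x : N a x -> sval a x = x.
  by case: a => rho [rhoK _ _] [y <-] /=; exact: rhoK.
have p_surj : surj p by move=> x; exists (dbase (x, 0%N)); exact: pE.
have LP : liftable (free_mod A (F * nat)%type).
  by apply: projective_liftable => //; exact: free_mod_projective.
have /choice[j jE] (ab : Ix * Ix) :
    exists c : Ix, N ab.1 `<=` N c /\ N ab.2 `<=` N c.
  case: ab => [[r1 [r1K pr1 [V1 r1V]]] [r2 [r2K pr2 [V2 r2V]]]].
  (* [r1] and [r2] vanish on the basis vectors outside [V1] and [V2], so an idempotent that fixes
     the finite list [L] fixes both images. *)
  pose L := [seq r1 (dbase b) | b <- V1] ++ [seq r2 (dbase b) | b <- V2].
  have [|r [rK pr rV] rL] := flat_idempotent_exists pE (L := L) flatF.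
    by move=> l; rewrite mem_cat => /orP[] /mapP[b _ ->].
  have Pr : flat_idempotent p r by split.
  have rr (r' : {linear free_mod A (F * nat)%type -> free_mod A (F * nat)%type})
      V : {subset [seq r' (dbase b) | b <- V] <= L} ->
      (forall b, b \notin V -> r' (dbase b) = 0) ->
      forall x, r (r' x) = r' x.
    move=> sub r'V x; have : r \o r' =1 r'; last by apply.
    apply: free_mod_ext => b /=; have [bV|bV] := boolP (b \in V).
      by rewrite rL //; apply: sub; exact: map_f.
    by rewrite r'V // linear0.
  exists (exist _ r Pr); split=> _ [y <-] /=; rewrite /N /=.
    exists (r1 y); apply: rr r1V _ => l lr.
    by rewrite mem_cat lr.
  exists (r2 y); apply: rr r2V _ => l lr.
  by rewrite mem_cat lr orbT.
apply: (liftable_quot_on p_surj LP).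
rewrite (_ : [set y | p y = 0] = [set x | x = 0 \/ exists a, N a x]); last first.
  apply/seteqP; split=> x /=.
    move=> px; right.
    have [|r Pr rx] := flat_idempotent_exists pE (L := [:: x]) flatF.
      by move=> l; rewrite inE => /eqP->.
    by exists (exist _ r Pr); exists x; apply: rx; rewrite inE.
  case=> [->|[[r Pr] [y <-]]] /=; first exact: linear0.
  by case: Pr => _ pr _; exact: pr.
(* [N a] is a direct summand; composing [u] with its projection gives a cycle on the whole free
   module. *)
have NL a : lifts_on C (N a).
  move=> i u du; have [x _|v vE] := LP i (u \o sval a).
    by apply: du; exists x.
  by exists v => x Nx; rewrite vE //= Nfix.
apply: (@lifts_on_directed_union _ _ acC injC _ {classic Ix} N
  (fun a b => j (a, b))) => //.
- by move=> a; exact: image_submod.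
- by move=> a b; have [] := jE (a, b).
- by move=> a b; have [] := jE (a, b).
Qed.

End LiftableModules.

(** * Enough injective modules *)

(** Euclidean division by the least positive member; the zero ideal has [n = 0]. *)
Lemma int_ideal_principal (S : set int) :
    S 0 -> (forall k l, S k -> S l -> S (k + l)) ->
    (forall c k, S k -> S (c * k)) ->
  exists n : nat, S n /\ forall k, S k -> exists c, k = c * n%:Z.
Proof.
move=> S0 SD SM.
have [[n [n_gt0 Sn]]|none] := pselect (exists n : nat, (0 < n)%N /\ S n); last first.
  exists 0%N; split=> // k Sk; exists 0; rewrite mul0r.
  apply: contrapT => /eqP k0; apply: none; exists `|k|%N; rewrite absz_gt0 k0.
  by split=> //; rewrite abszEsign; exact: SM.
have exn : exists n : nat, `[< (0 < n)%N /\ S n >] by exists n; apply/asboolP.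
case: (ex_minnP exn) => m /asboolP[m_gt0 Sm] minm.
exists m; split=> // k Sk; exists (k %/ m)%Z.
have m0 : m%:Z != 0 by rewrite eqz_nat -lt0n.
rewrite [LHS](divz_eq k m); case: (eqVneq (k %% m)%Z 0) => [->|r0].
  by rewrite addr0.
have r_ge0 := modz_ge0 k m0.
have Sr : S `|(k %% m)%Z|%N.
  rewrite gez0_abs // /modz; apply: SD => //.
  by rewrite -mulNr; exact: SM.
have := minm `|(k %% m)%Z|%N; rewrite asboolT; last first.
  by rewrite absz_gt0 r0.
move=> /(_ isT); rewrite leqNgt -ltz_nat gez0_abs //.
by rewrite ltz_mod.
Qed.

(** * Divisible groups and Baer's argument over the integers *)

Section Divisible.
Variable D : lmodType int.
Hypothesis divD : forall (n : nat) (d : D), (0 < n)%N -> exists e, n%:Z *: e = d.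
Variable Z : lmodType int.

Let linear_on (H : set Z) (chi : Z -> D) : Prop :=
  forall a x y, H x -> H y -> chi (a *: x + y) = a *: chi x + chi y.

(** The [k] with [k *: z] in [H] are the multiples of some [n]. Divisibility gives [q] whose
    [n]-fold multiple is [chi (n%:Z *: z)], and [z] can then be sent to [q] consistently. *)
Let extend_one (H : set Z) (chi : Z -> D) (z : Z) :
    is_submod H -> linear_on H chi ->
  exists (H' : set Z) (chi' : Z -> D),
    [/\ is_submod H', linear_on H' chi', H `<=` H', H' z &
       forall x, H x -> chi' x = chi x].
Proof.
move=> [H0 HD HZ] chil.
have chi0 : chi 0 = 0.
  have := chil 1 0 0 H0 H0; rewrite scaler0 add0r scale1r => e.
  by apply: (addIr (chi 0)); rewrite add0r -e.
have chiZ a x : H x -> chi (a *: x) = a *: chi x.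
  by move=> Hx; have := chil a x 0 Hx H0; rewrite chi0 !addr0.
have [n [Hn nP]] : exists n : nat, H (n%:Z *: z) /\
    forall k : int, H (k *: z) -> exists c, k = c * n%:Z.
  apply: (@int_ideal_principal [set k | H (k *: z)]) => /=.
  - by rewrite scale0r.
  - by move=> k l Hk Hl; rewrite scalerDl; exact: HD.
  - by move=> c k Hk; rewrite -scalerA; exact: HZ.
have [q qE] : exists q : D, n%:Z *: q = chi (n%:Z *: z).
  case: (posnP n) => [->|n0]; last exact: divD.
  by exists 0; rewrite !scale0r chi0.
have qP k : H (k *: z) -> chi (k *: z) = k *: q.
  by move=> /nP[c ->]; rewrite -!scalerA chiZ // qE.
have /choice[chi' chi'E] (w : Z) : exists d, forall h k, H h ->
    w = h + k *: z -> d = chi h + k *: q.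
  have [[h [k [Hh wE]]]|none] := pselect (exists h k, H h /\ w = h + k *: z).
    exists (chi h + k *: q) => h' k' Hh'; rewrite wE => e.
    have e' : (k - k') *: z = (-1) *: h + h'.
      by rewrite scaleN1r scalerBl; apply/eqP;
        rewrite subr_eq -addrA -e addKr.
    have := qP (k - k'); rewrite e' chil // => /(_ _)/esym.
    have Hh'' : H (-1 *: h + h') by apply: HD => //; exact: HZ.
    move=> /(_ Hh''); rewrite scalerBl scaleN1r => /eqP.
    rewrite subr_eq => /eqP->; by rewrite -addrA addNKr.
  by exists 0 => h k Hh wE; case: none; exists h, k.
pose H' : set Z := [set w | exists h k, H h /\ w = h + k *: z].
exists H', chi'; split.
- split.
  + by exists 0, 0; rewrite scale0r addr0.
  + move=> _ _ [h [k [Hh ->]]] [h' [k' [Hh' ->]]].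
    exists (h + h'), (k + k'); split; first exact: HD.
    by rewrite scalerDl addrACA.
  + move=> a _ [h [k [Hh ->]]]; exists (a *: h), (a * k); split; first exact: HZ.
    by rewrite scalerDr scalerA.
- move=> a _ _ [h [k [Hh ->]]] [h' [k' [Hh' ->]]].
  rewrite (chi'E (a *: (h + k *: z) + (h' + k' *: z))
                 (a *: h + h') (a * k + k')); last 2 first.
  + by apply: HD => //; exact: HZ.
  + by rewrite scalerDr scalerDl scalerA addrACA.
  rewrite (chi'E (h + k *: z) h k) // (chi'E (h' + k' *: z) h' k') // chil //.
  by rewrite scalerDr scalerDl scalerA addrACA.
- by move=> h Hh; exists h, 0; rewrite scale0r addr0.
- by exists 0, 1; rewrite scale1r add0r.
- by move=> h Hh; rewrite (chi'E h h 0) ?scale0r ?addr0.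
Qed.

(** Zorn's lemma on partial extensions: by [extend_one], a maximal one is defined everywhere. *)
Lemma divisible_extend (H : set Z) (chi : Z -> D) :
    is_submod H -> linear_on H chi ->
  exists w : {linear Z -> D}, forall x, H x -> w x = chi x.
Proof.
move=> subH chil.
pose ok (p : set Z * (Z -> D)) :=
  [/\ is_submod p.1, linear_on p.1 p.2, H `<=` p.1 &
     forall x, H x -> p.2 x = chi x].
pose T := {p | ok p}.
pose R (p q : T) := `[< (sval p).1 `<=` (sval q).1 /\
  forall x, (sval p).1 x -> (sval q).2 x = (sval p).2 x >].
have okH : ok (H, chi) by split.
have [||F Ftot|[[E v] okE] maxp] := @ZL_preorder T (exist _ _ okH) R.
- by move=> t; apply/asboolP; split.
- move=> r s t /asboolP[rs rsE] /asboolP[st stE]; apply/asboolP; split.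
    exact: subset_trans st.
  by move=> x Kx; rewrite stE ?rsE //; exact: rs.
- have [[q0 Fq0]|Fnone] := pselect (exists q, F q); last first.
    by exists (exist _ _ okH) => s Fs; case: Fnone; exists s.
  have agree (q q' : T) x : F q -> F q' -> (sval q).1 x ->
      (sval q').1 x -> (sval q).2 x = (sval q').2 x.
    move=> Fq Fq' Kx Kx'.
    have [/asboolP[_ h]|/asboolP[_ h]] := Ftot _ _ Fq Fq'; last exact: h.
    by rewrite h.
  have /choice[v vE] (x : Z) : exists y : D, forall q, F q ->
      (sval q).1 x -> y = (sval q).2 x.
    have [[q [Fq Kx]]|none] := pselect (exists q, F q /\ (sval q).1 x).
      by exists ((sval q).2 x) => q' Fq' Kx'; exact: agree.
    by exists 0 => q Fq Kx; case: none; exists q.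
  pose U : set Z := [set x | exists2 q, F q & (sval q).1 x].
  have both x y : U x -> U y ->
      exists q, [/\ F q, (sval q).1 x & (sval q).1 y].
    move=> [q Fq qx] [q' Fq' q'y].
    have [/asboolP[h _]|/asboolP[h _]] := Ftot _ _ Fq Fq'.
      by exists q'; split=> //; exact: h.
    by exists q; split=> //; exact: h.
  have okU : ok (U, v).
    split=> /=.
    + split.
      * by exists q0 => //; case: (svalP q0) => -[].
      * move=> x y Ux Uy; have [q [Fq qx qy]] := both _ _ Ux Uy.
        by exists q => //; case: (svalP q) => -[_ qD _] _ _ _; exact: qD.
      * move=> a x [q Fq qx]; exists q => //.
        by case: (svalP q) => -[_ _ qZ] _ _ _; exact: qZ.
    + move=> a x y Ux Uy; have [q [Fq qx qy]] := both _ _ Ux Uy.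
      case: (svalP q) => -[_ qD qZ] ql _ _.
      by rewrite !(vE _ q) ?ql //; apply: qD => //; exact: qZ.
    + move=> x Hx; exists q0 => //.
      by case: (svalP q0) => _ _ Hq _; exact: Hq.
    + move=> x Hx; case: (svalP q0) => _ _ Hq qE.
      by rewrite (vE x q0) ?qE //; exact: Hq.
  exists (exist _ _ okU) => q Fq; apply/asboolP; split=> /=.
    by move=> x qx; exists q.
  by move=> x qx; exact: vE.
- have [/= subE vl HE vE] := okE.
  have ET z : E z.
    have [H' [chi' [subH' chi'l EH' H'z chi'E]]] := extend_one z subE vl.
    have okH' : ok (H', chi').
      split=> //=; first exact: subset_trans EH'.
      by move=> x Hx; rewrite chi'E ?vE //; exact: HE.
    have /asboolP[/= H'E _] := maxp (exist _ _ okH') (asboolT (conj EH' chi'E)).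
    exact: H'E.
  have vlin : linear v by move=> a x y; exact: vl.
  by exists (lin_of vlin).
Qed.

End Divisible.

Lemma divisible_injective (D : lmodType int) :
    (forall (n : nat) (d : D), (0 < n)%N -> exists e, n%:Z *: e = d) ->
  injective_module D.
Proof.
move=> divD Y Z i g i_inj.
have /choice[chi chiE] (z : Z) : exists d, forall y, i y = z -> d = g y.
  have [[y <-]|none] := pselect (exists y, i y = z).
    by exists (g y) => y' /i_inj->.
  by exists 0 => y yz; case: none; exists y.
have [|w wE] := divisible_extend divD (chi := chi) (image_submod i).
  move=> a _ _ [x <-] [y <-].
  rewrite -(linearP i) (chiE _ (a *: x + y) erefl).
  by rewrite (chiE _ x erefl) (chiE _ y erefl) linearP.
by exists w => y /=; rewrite wE; [exact: chiE | exists y].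
Qed.

Section RatModInt.
Local Open Scope quotient_scope.

Definition int_rat : {pred rat} := [pred x | x \is a Num.int].

Fact int_rat_closed : zmod_closed int_rat.
Proof.
by split=> [|x y xi yi]; rewrite inE; [exact: rpred0 | exact: rpredB].
Qed.
HB.instance Definition _ := GRing.isZmodClosed.Build rat int_rat int_rat_closed.

Definition rat_mod_int : lmodType int :=
  zmodule (Quotient.quot int_rat).

Definition rat_mod_int_pi (x : rat) : rat_mod_int :=
  \pi_(Quotient.quot int_rat) x.

Lemma rat_mod_int_piD x y :
  rat_mod_int_pi (x + y) = rat_mod_int_pi x + rat_mod_int_pi y.
Proof. exact: Quotient.pi_add. Qed.

Lemma rat_mod_int_pi_eq0 x : rat_mod_int_pi x = 0 <-> x \is a Num.int.
Proof.
have pi0 : rat_mod_int_pi 0 = 0.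
  by apply: (addIr (rat_mod_int_pi 0)); rewrite -rat_mod_int_piD !add0r.
rewrite -pi0 /rat_mod_int_pi.
have := Quotient.idealrBE int_rat x 0; rewrite subr0 inE => ->.
by split=> /eqP.
Qed.

Lemma rat_mod_int_piMz x (n : int) :
  rat_mod_int_pi (n%:~R * x) = n *: rat_mod_int_pi x.
Proof.
have piB : zmod_morphism rat_mod_int_pi.
  move=> y z; apply: (addIr (rat_mod_int_pi z)).
  by rewrite -rat_mod_int_piD !subrK.
pose pi : {additive rat -> rat_mod_int} :=
  HB.pack rat_mod_int_pi (GRing.isZmodMorphism.Build _ _ _ piB).
by rewrite mulrzl; exact: (raddfMz pi).
Qed.

Lemma rat_mod_int_piP (d : rat_mod_int) : exists x, rat_mod_int_pi x = d.
Proof. by exists (repr (d : Quotient.quot int_rat)); exact: reprK. Qed.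

End RatModInt.

Lemma rat_mod_int_injective : injective_module rat_mod_int.
Proof.
apply: divisible_injective => n d n_gt0; have [x <-] := rat_mod_int_piP d.
exists (rat_mod_int_pi (n%:R^-1 * x)); rewrite -rat_mod_int_piMz mulrA.
by rewrite mulfV ?mul1r // pnatr_eq0 -lt0n.
Qed.

(** The span of [z] has a map sending [z] to the class of a suitable non-integer [q]; injectivity of
    Q/Z extends it to [Z]. *)
Lemma rat_mod_int_cogenerator (Z : lmodType int) (z : Z) : z != 0 ->
  exists f : {linear Z -> rat_mod_int}, f z != 0.
Proof.
move=> z0.
have [n [nz nP]] := @int_ideal_principal [set k : int | k *: z = 0]
  (scale0r z)
  (fun k l kz lz => etrans (scalerDl z k l) (etrans (congr2 +%R kz lz) (addr0 0)))
  (fun c k kz => etrans (esym (scalerA c k z)) (etrans (congr1 _ kz) (scaler0 _ c))).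
have n1 : n != 1%N by apply: contra z0 => /eqP n1; rewrite -nz n1 scale1r.
(* [n] generates the annihilator of [z]; [q] is the inverse of [n], or one half when [n] is zero. *)
have [q qnz nq] : exists2 q : rat, q \isn't a Num.int & n%:~R * q \is a Num.int.
  case: (posnP n) => [->|n_gt0].
    by exists 2%:R^-1 => //; rewrite mul0r rpred0.
  have n0 : n%:~R != 0 :> rat by rewrite intr_eq0 eqz_nat -lt0n.
  exists n%:~R^-1; last by rewrite mulfV ?rpred1.
  apply/negP => /intrP[m mE].
  have : (n%:Z * m)%:~R = 1 :> rat by rewrite intrM -mE mulfV.
  move=> /eqP; rewrite -[1]/(1%:~R) eqr_int => /eqP nm.
  have : (n%:Z %| 1)%Z by apply/dvdzP; exists m; rewrite mulrC.
  by rewrite dvdz1 /= (negPf n1).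
have /choice[v vE] (w : Z) : exists d, forall k : int, w = k *: z ->
    d = k *: rat_mod_int_pi q.
  have [[k ->]|none] := pselect (exists k : int, w = k *: z); last first.
    by exists 0 => k wE; case: none; exists k.
  exists (k *: rat_mod_int_pi q) => l /eqP; rewrite -subr_eq0 -scalerBl.
  move=> /eqP/nP[c e]; apply/eqP; rewrite -subr_eq0 -scalerBl e -scalerA.
  rewrite -rat_mod_int_piMz; apply/eqP.
  by rewrite (rat_mod_int_pi_eq0 _).2 // scaler0.
pose N : set Z := [set w | exists k : int, w = k *: z].
have [||f fE] := injective_extend_partial rat_mod_int_injective (N := N) (v := v).
- split=> [|_ _ [k ->] [l ->]|a _ [k ->]].
  + by exists 0; rewrite scale0r.
  + by exists (k + l); rewrite scalerDl.
  + by exists (a * k); rewrite scalerA.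
- move=> a _ _ [k ->] [l ->]; rewrite scalerA -scalerDl.
  by rewrite !(vE _ _ erefl) scalerDl scalerA.
exists f; rewrite fE; last by exists 1; rewrite scale1r.
rewrite (vE z 1) ?scale1r //; apply: contra qnz => /eqP.
by move/rat_mod_int_pi_eq0.
Qed.

Section Coextension.
Variables (A B : comPzRingType) (f : {rmorphism A -> B}).

Definition restr_map (X Y : lmodType B) (g : {linear X -> Y}) :
  restr X f -> restr Y f := g.

Fact restr_map_linear (X Y : lmodType B) (g : {linear X -> Y}) : linear (restr_map g).
Proof. by move=> a x y; exact: (linearP g (f a)). Qed.
HB.instance Definition _ (X Y : lmodType B) (g : {linear X -> Y}) :=
  GRing.isLinear.Build A (restr X f) (restr Y f) _ (restr_map g)
    (restr_map_linear g).

Lemma coextscal_adjoint (Z : lmodType B) (X : lmodType A)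
    (g : {linear restr Z f -> X}) :
  exists h : {linear Z -> coextscal f X},
    forall z (s : algmod f), (h z : hom (algmod f) X) s = g ((s : B) *: (z : Z)).
Proof.
have gl z : linear (fun s : algmod f => g ((s : B) *: (z : Z))).
  move=> a s t; rewrite -linearP; congr (g _).
  by rewrite [LHS]scalerDl; congr (_ + _); rewrite /= -scalerA.
have hl : linear (fun z => lin_of (gl z) : coextscal f X).
  move=> b z w; apply: homP => s /=.
  rewrite -[RHS]/(g ((b * (s : B)) *: (z : Z)) + g ((s : B) *: (w : Z))).
  by rewrite -linearD scalerDr scalerA mulrC.
by exists (lin_of hl).
Qed.

(** Coextension is right adjoint to restriction of scalars, which preserves injections. *)
Lemma coextscal_injective (X : lmodType A) :
  injective_module X -> injective_module (coextscal f X).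
Proof.
move=> injX Y Z i g i_inj.
have g1l : linear (fun y : restr Y f => (g y : hom (algmod f) X) (1 : B)).
  move=> a y z; rewrite -[LHS]/((g (f a *: (y : Y) + z) : hom _ _) (1 : B)).
  rewrite linearP -[LHS]/((g y : hom _ _) (f a * 1 : B) + _); congr (_ + _).
  by rewrite -linearZ; congr ((g y : hom _ _) _).
have [h hE] := injX _ _ (restr_map i) (lin_of g1l) i_inj.
have [k kE] := coextscal_adjoint h.
exists k => y; apply: homP => s /=; rewrite kE -linearZ.
have /= -> := hE ((s : B) *: (y : Y)).
rewrite linearZ -[LHS]/((g y : hom _ _) ((s : B) * 1 : B)).
by congr ((g y : hom _ _) _); exact: mulr1.
Qed.

End Coextension.

Arguments restr_map {A B} f {X Y} g.

Lemma fun_injective (A : comPzRingType) (T : Type) (I : lmodType A) :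
  injective_module I -> injective_module (T -> I).
Proof.
move=> injI Y Z i g i_inj.
have gl t : linear (fun y => g y t) by move=> a x y; rewrite linearP.
have /choice[h hE] t : exists h : {linear Z -> I}, h \o i =1 lin_of (gl t).
  exact: injI.
have kl : linear (fun z => (h^~ z : T -> I)).
  by move=> a x y; apply/funext => t; rewrite linearP.
by exists (lin_of kl) => y; apply/funext => t; exact: hE.
Qed.

(** Evaluation embeds [X] into the coextension, from the integers to [A], of a power of Q/Z indexed
    by all characters of [X], because characters separate points. *)
Lemma enough_injectives (A : comPzRingType) (X : lmodType A) :
  exists2 I : lmodType A, injective_module I &
    exists i : {linear X -> I}, injective i.
Proof.
pose f : {rmorphism int -> A} := intmul 1.
pose T := {linear restr X f -> rat_mod_int}.
pose D : lmodType int := T -> rat_mod_int.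
exists (coextscal f D).
  by apply: coextscal_injective; apply: fun_injective;
    exact: rat_mod_int_injective.
have gl : linear (fun (x : restr X f) => (fun t : T => t x) : D).
  by move=> a x y; apply/funext => t; rewrite linearP.
have [i iE] := coextscal_adjoint (lin_of gl).
exists i => x y ixy; apply/subr0_eq/eqP/negPn/negP => xy.
have [t /eqP[]] := @rat_mod_int_cogenerator (restr X f) _ xy.
have := congr1 (fun h : hom (algmod f) D => h (1 : A) t) ixy.
by rewrite !iE /= !scale1r => e; rewrite linearB; apply/eqP; rewrite subr_eq0 e.
Qed.

(** * Coextension of Gorenstein injective modules *)

Section GorensteinInjective.
Variables (A B : comPzRingType) (f : {rmorphism A -> B}) (C : sequence A).
Hypotheses (acC : acyclic C) (injC : forall i, injective_module (C i)).
Hypothesis Cinj : forall J, injective_module J -> Hom_from_exact J C.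

Lemma fd_finite_liftable (X : lmodType A) : fd_finite X -> liftable C X.
Proof.
move=> [n [F [flatF F0]]]; apply: (resolution_ind (F := F) (n := n)) => //.
- exact: zero_liftable.
- by move=> K Y Z i p; exact: liftable_quot.
- by move=> k; exact: flat_liftable.
Qed.

(** Maps into [hom X I] correspond to maps into [I] from tensor products with [X], and tensoring
    with a flat module preserves injections. *)
Lemma hom_flat_injective (X I : lmodType A) :
  flat X -> injective_module I -> injective_module (hom X I).
Proof.
move=> flatX injI Y Z i g i_inj.
have [y|x|g' [g'E _]] := @tensor_universal A Y X I (fun y x => (g y : hom X I) x).
- exact: linearP.
- by move=> a u v; rewrite linearP.
have iX_inj : injective (tensor_map X i).
  have ex0 : exact_pair (submod_incl (ker_submod i)) i.
    move=> y; split=> [iy|[z <-]]; last exact: (submod_inclP z).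
    exact: (@submod_inclK _ _ _ (ker_submod i)).
  move=> u v e; apply/subr0_eq.
  have [|w <-] := (flatX _ _ _ _ _ ex0 (u - v)).1.
    by rewrite linearB; apply/eqP; rewrite subr_eq0; apply/eqP; exact: e.
  rewrite (tensorE w) linear_sum big1 // => q _.
  rewrite [LHS]tensor_map_tens (_ : submod_incl _ q.1 = 0) ?tens0l //.
  by apply: i_inj; rewrite linear0; exact: (submod_inclP q.1).
have [h hE] := injI _ _ (tensor_map X i) g' iX_inj.
have hzl (z : Z) : linear (fun x => h (tens z x)).
  by move=> a x y; rewrite tensDr -tensZr linearP.
have hl : linear (fun z => lin_of (hzl z) : hom X I).
  move=> a z w; apply: homP => x /=.
  rewrite -[RHS]/(a *: h (tens z x) + h (tens w x)).
  by rewrite tensDl -tensZl linearP.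
exists (lin_of hl) => y; apply: homP => x /=.
by rewrite -g'E -hE /= tensor_map_tens.
Qed.

Lemma hom_pre_linear (X Y Z : lmodType A) (g : {linear X -> Y}) :
  linear (@hom_pre A X Y g Z).
Proof. by move=> a h k; apply: homP. Qed.

(** When [Z] is the quotient of [Y] by [K], [hom Z I] is the kernel of the surjection from [hom Y I]
    to [hom K I], so [liftable_sub] drives the induction along the flat resolution. *)
Lemma fd_finite_hom_liftable (X I : lmodType A) :
  fd_finite X -> injective_module I -> liftable C (hom X I).
Proof.
move=> [n [F [flatF F0]]] injI.
apply: (@resolution_ind _ (fun X => liftable C (hom X I)) _ F n) => //.
- move=> Z Z0; apply: zero_liftable => h.
  by apply: homP => z; rewrite (Z0 z) !linear0.
- move=> K Y Z i p i_inj exip p_surj LK LY.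
  apply: (liftable_sub acC injC (i := lin_of (@hom_pre_linear _ _ I p))
    (p := lin_of (@hom_pre_linear _ _ I i)) _ _ _ LY LK).
  + move=> g h e; apply: homP => z; have [y <-] := p_surj z.
    exact: (congr1 (fun k : hom Y I => k y) e).
  + move=> h; split=> [hi|[g <-]]; last first.
      apply: homP => k; rewrite /= (exip (i k)).2; last by exists k.
      exact: linear0.
    have [y py|g gE] := factor_through_surj (p := p) (f := h) p_surj.
      have /exip[k <-] := py.
      exact: (congr1 (fun g : hom K I => g k) hi).
    by exists g; apply: homP => y; exact: gE.
  + move=> h; have [g gE] := injI _ _ i h i_inj.
    by exists g; apply: homP => k; exact: gE.
- move=> k; apply/(liftableP _ acC)/Cinj.
  exact: hom_flat_injective.
Qed.

(** Embedding [restr J f] in an injective [I] embeds [J] in [coextscal f I] by adjunction; as [J] is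
    injective, this embedding splits. *)
Lemma injective_restr_liftable (J : lmodType B) :
  fd_finite (algmod f) -> injective_module J -> liftable C (restr J f).
Proof.
move=> fdB injJ; have [I injI [i i_inj]] := enough_injectives (restr J f).
have [s sE] := coextscal_adjoint i.
have s_inj : injective s.
  move=> x y e; apply: i_inj.
  have := congr1 (fun h : hom (algmod f) I => h (1 : B)) e.
  by rewrite !sE !scale1r.
have [r rE] := injJ _ _ s idfun s_inj.
(* The two modules have the same elements; [a] acts on the argument in one and on the value in the
   other, which agree by linearity. *)
have hom_coext : linear (idfun : restr (coextscal f I) f -> hom (algmod f) I).
  move=> a g h; apply: homP => t.
  rewrite -[RHS]/(a *: (g : hom _ _) t + (h : hom _ _) t) -linearZ.
  by [].
have coext_hom : linear (idfun : hom (algmod f) I -> restr (coextscal f I) f).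
  move=> a g h; apply: homP => t.
  rewrite -[LHS]/(a *: (g : hom _ _) t + (h : hom _ _) t) -linearZ.
  by [].
pose s' : {linear restr J f -> hom (algmod f) I} :=
  lin_of hom_coext \o restr_map f s.
pose r' : {linear hom (algmod f) I -> restr J f} :=
  restr_map f r \o lin_of coext_hom.
apply: (liftable_retract (s := s') (r := r')).
  by move=> x; exact: rE.
exact: fd_finite_hom_liftable.
Qed.

Definition coext_map (X Y : lmodType A) (g : {linear X -> Y}) :
  coextscal f X -> coextscal f Y := @hom_post A X Y g (algmod f).

Fact coext_map_linear (X Y : lmodType A) (g : {linear X -> Y}) : linear (coext_map g).
Proof.
move=> b h k; apply: homP => s.
rewrite -[LHS]/(g ((h : hom _ _) (b * (s : B) : B) + (k : hom _ _) s)).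
by rewrite linearD.
Qed.
HB.instance Definition _ (X Y : lmodType A) (g : {linear X -> Y}) :=
  GRing.isLinear.Build B (coextscal f X) (coextscal f Y) _ (coext_map g)
    (coext_map_linear g).

End GorensteinInjective.

Arguments coext_map {A B} f {X Y} g.

(** By adjunction, lifting from [J] against the coextended complex amounts to lifting from
    [restr J f] against [C]. *)
Lemma Gorenstein_injective_coextscal (A B : comPzRingType)
    (f : {rmorphism A -> B}) (M : lmodType A) :
    fd_finite (algmod f) -> Gorenstein_injective M ->
  Gorenstein_injective (coextscal f M).
Proof.
move=> fdB [C [acC injC Cinj [phi phi_inj phiE]]].
pose D := Sequence (fun i => coext_map f (seq_diff C i) :
  {linear coextscal f (C i) -> coextscal f (C (i - 1))}).
have LB : liftable C (algmod f) by exact: fd_finite_liftable.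
have acD : acyclic D by move=> i; exact: (liftableP _ acC).1 LB i.
exists D; split=> //.
- by move=> i; apply: coextscal_injective; exact: injC.
- move=> J injJ; apply/(liftableP _ acD) => i u du.
  have ul : linear (fun x : restr J f => (u x : hom (algmod f) _) (1 : B)).
    move=> a y z; rewrite -[LHS]/((u (f a *: (y : J) + z) : hom _ _) (1 : B)).
    rewrite linearP -[LHS]/((u y : hom _ _) (f a * 1 : B) + _); congr (_ + _).
    by rewrite -linearZ; congr ((u y : hom _ _) _).
  have LJ : liftable C (restr J f) by exact: injective_restr_liftable.
  have [x _|v vE] := LJ i (lin_of ul).
    exact: (congr1 (fun h : hom (algmod f) _ => h (1 : B)) (du x I)).
  have [w wE] := coextscal_adjoint v.
  exists w => x _; apply: homP => s.
  rewrite -[LHS]/(seq_diff C i ((w x : hom _ _) s)) wE vE //.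
  rewrite -[LHS]/((u ((s : B) *: (x : J)) : hom _ _) (1 : B)) linearZ.
  rewrite -[LHS]/((u x : hom _ _) ((s : B) * 1 : B)).
  by congr ((u x : hom _ _) _); exact: mulr1.
(* The maps from [algmod f] with values in the image of [phi] are the cycles of [D] in degree
   [0 - 1], which are boundaries by [acD]. *)
- exists (coext_map f phi).
    move=> g h e; apply: homP => s; apply: phi_inj.
    exact: (congr1 (fun k : hom (algmod f) _ => k s) e).
  move=> h; split=> [[g <-]|[g <-]].
    apply/acD; apply: homP => s.
    by apply/acC/phiE; exists ((g : hom _ _) s).
  have [s|k kE] := factor_through_inj (f := hom_post (seq_diff C 0) g) phi_inj.
    by apply/phiE; exists ((g : hom _ _) s).
  by exists k; apply: homP => s; exact: kE.
Qed.

(** * Tensor products with projective modules *)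

Section TensorMapr.
Variables (A : comPzRingType) (P Y Z : lmodType A) (g : {linear Y -> Z}).

Fact tensor_mapr_subproof :
  {h : {linear tensor P Y -> tensor P Z} |
    forall x y, h (tens x y) = tens x (g y)}.
Proof.
apply: cid.
have [x|y|h [hE _]] := @tensor_universal A P Y _ (fun x y => tens x (g y)).
- by move=> a y z; rewrite linearP tensDr -tensZr.
- by move=> a x z; rewrite tensDl -tensZl.
- by exists h.
Qed.

Definition tensor_mapr : {linear tensor P Y -> tensor P Z} :=
  sval tensor_mapr_subproof.

Lemma tensor_mapr_tens x y : tensor_mapr (tens x y) = tens x (g y).
Proof. exact: (svalP tensor_mapr_subproof). Qed.

Lemma tensor_mapr_surj : surj g -> surj tensor_mapr.
Proof.
move=> g_surj; elim/tensor_ind => [|x z|_ _ [u <-] [v <-]].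
- by exists 0; rewrite linear0.
- by have [y <-] := g_surj z; exists (tens x y); rewrite tensor_mapr_tens.
- by exists (u + v); rewrite linearD.
Qed.

End TensorMapr.

Arguments tensor_mapr {A} P {Y Z} g.

Section TensorProjective.
Variables (A : comPzRingType).
Implicit Types P X Y Z : lmodType A.

Lemma tensor_map_surj X Y Z (g : {linear Y -> Z}) :
  surj g -> surj (tensor_map X g).
Proof.
move=> g_surj; elim/tensor_ind => [|z x|_ _ [u <-] [v <-]].
- by exists 0; rewrite linear0.
- have [y <-] := g_surj z; exists (tens y x); exact: tensor_map_tens.
- by exists (u + v); rewrite linearD.
Qed.

Lemma tensor_mapC X X' Y Y' (g : {linear X -> X'}) (h : {linear Y -> Y'}) w :
  tensor_map Y' g (tensor_mapr X h w) = tensor_mapr X' h (tensor_map Y g w).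
Proof.
move: w; apply: tensor_morph_ext => [u v|u v|x y]; do ?by rewrite !linearD.
by rewrite tensor_mapr_tens [LHS]tensor_map_tens [X in tensor_mapr _ _ X]tensor_map_tens
  tensor_mapr_tens.
Qed.

Lemma tensor_map_comp0 X Y Z T (g : {linear X -> Y}) (h : {linear Y -> Z}) w :
  (forall x, h (g x) = 0) -> tensor_map T h (tensor_map T g w) = 0.
Proof.
move=> hg; move: w; apply: (tensor_morph_ext (h := fun=> 0)) => [u v|u v|x y].
- by rewrite !linearD.
- by rewrite addr0.
- by rewrite [X in tensor_map _ _ X]tensor_map_tens [LHS]tensor_map_tens hg tens0l.
Qed.

Lemma tensor_mapr_comp0 X Y Z T (g : {linear X -> Y}) (h : {linear Y -> Z}) w :
  (forall x, h (g x) = 0) -> tensor_mapr T h (tensor_mapr T g w) = 0.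
Proof.
move=> hg; move: w; apply: (tensor_morph_ext (h := fun=> 0)) => [u v|u v|x y].
- by rewrite !linearD.
- by rewrite addr0.
- by rewrite !tensor_mapr_tens hg tens0r.
Qed.

(* Expanding the first factors along a dual basis of [P] turns a relation in
   [P (x) Z] into relations in [Z]. *)
Lemma tensor_mapr_ker P Y Z (g : {linear Y -> Z}) (w : tensor P Y) :
    projective P -> tensor_mapr P g w = 0 ->
  exists2 s : seq (P * Y), (forall q, q \in s -> g q.2 = 0) &
    w = \sum_(q <- s) tens q.1 q.2.
Proof.
move=> projP gw; have [c cE] := projective_dual_basis projP.
pose S := undup (flatten [seq dsupp (c q.1) | q <- tensor_repr w]).
have qE q : q \in tensor_repr w ->
    q.1 = \sum_(b <- S) (dcoord b (c q.1) : A) *: b.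
  move=> qw; apply: cE => [|b]; first exact: undup_uniq.
  rewrite mem_undup => bS; apply: dsuppP; apply: contra bS => bq.
  by apply/flattenP; exists (dsupp (c q.1)) => //; apply/mapP; exists q.
have cl b : linear (fun x => dcoord b (c x)) by move=> a x y; rewrite !linearP.
(* [ev b] contracts the first factor with the coordinate [b]; this commutes with [g], so [ev b w]
   lies in the kernel of [g]. *)
have /choice[ev evE] b := tensor_eval Y (lin_of (cl b)).
have /choice[ev' ev'E] b := tensor_eval Z (lin_of (cl b)).
have gev b : g (ev b w) = 0.
  transitivity (ev' b (tensor_mapr P g w)); last by rewrite gw linear0.
  move: (w); apply: tensor_morph_ext => [u v|u v|x y]; do ?by rewrite !linearD.
  by rewrite evE tensor_mapr_tens ev'E linearZ.
exists [seq (b, ev b w) | b <- S]; first by move=> _ /mapP[b _ ->] /=.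
rewrite big_map /= {1}(tensorE w).
transitivity (\sum_(q <- tensor_repr w) \sum_(b <- S)
    tens b ((dcoord b (c q.1) : A) *: q.2) : tensor P Y).
  rewrite big_seq [RHS]big_seq; apply: eq_bigr => q qw.
  rewrite {1}(qE q qw) tens_suml; apply: eq_bigr => b _; exact: tensZ.
rewrite exchange_big; apply: eq_bigr => b _ /=; rewrite -tens_sumr.
rewrite -[w in RHS]tensor_reprK tensor_sumE linear_sum; congr tens.
by apply: eq_bigr => q _; rewrite evE.
Qed.

Lemma tensor_mapr_exact P X Y Z (g : {linear X -> Y}) (h : {linear Y -> Z}) :
    projective P -> exact_pair g h ->
  exact_pair (tensor_mapr P g) (tensor_mapr P h).
Proof.
move=> projP exgh w; split=> [hw|[v <-]]; last first.
  by apply: tensor_mapr_comp0 => x; apply/exgh; exists x.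
have [s sE ->] := tensor_mapr_ker projP hw.
elim: s sE {hw} => [|q s IHs] sE.
  by exists 0; rewrite big_nil linear0.
have [|v vE] := IHs; first by move=> r rs; apply: sE; rewrite inE rs orbT.
have /exgh[x xq] : h q.2 = 0 by apply: sE; rewrite inE eqxx.
exists (tens q.1 x + v).
by rewrite linearD big_cons vE /= tensor_mapr_tens xq.
Qed.

Lemma tensor_mapr_inj P Y Z (g : {linear Y -> Z}) :
  projective P -> injective g -> injective (tensor_mapr P g).
Proof.
move=> projP g_inj u v e; apply/subr0_eq.
have [|s sE ->] := tensor_mapr_ker (g := g) (w := u - v) projP.
  by rewrite linearB e subrr.
rewrite big_seq big1 // => q qs.
by rewrite (_ : q.2 = 0) ?tens0r //; apply: g_inj; rewrite linear0 sE.
Qed.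

Lemma tensor_swap X Y :
  exists h : {linear tensor X Y -> tensor Y X},
    forall x y, h (tens x y) = tens y x.
Proof.
have [x|y|h [hE _]] := @tensor_universal A X Y _ (fun x y => tens y x).
- by move=> a y z; rewrite tensDl -tensZl.
- by move=> a x z; rewrite tensDr -tensZr.
- by exists h.
Qed.

(** [flat] has the module as second factor; exactness of [tensor_mapr], where it comes first, is
    carried over by swapping factors. *)
Lemma projective_flat P : projective P -> flat P.
Proof.
move=> projP X Y Z g h exgh w.
have [s sE] := tensor_swap Y P; have [t tE] := tensor_swap P Y.
have [s' s'E] := tensor_swap Z P; have [t' t'E] := tensor_swap P X.
split=> [hw|[v <-]]; last first.
  by apply: tensor_map_comp0 => x; apply/exgh; exists x.
have [|v vE] := (tensor_mapr_exact projP exgh (s w)).1.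
  transitivity (s' (tensor_map P h w)); last by rewrite hw linear0.
  move: (w); apply: tensor_morph_ext => [u v|u v|y x]; do ?by rewrite !linearD.
  by rewrite sE tensor_mapr_tens [X in s' X]tensor_map_tens s'E.
exists (t' v); transitivity (t (tensor_mapr P g v)).
  move: (v); apply: tensor_morph_ext => [u u'|u u'|x y]; do ?by rewrite !linearD.
  by rewrite t'E tensor_mapr_tens tE [LHS]tensor_map_tens.
rewrite vE; move: (w); apply: tensor_morph_ext => [u u'|//|y x].
  by rewrite !linearD.
by rewrite sE tE.
Qed.

End TensorProjective.

(** * Acyclic complexes of projective modules *)

Section TensorAcyclic.
Variables (A : comPzRingType) (C : sequence A).
Hypotheses (acC : acyclic C) (projC : forall i, projective (C i)).

Definition tensor_acyclic (X : lmodType A) : Prop :=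
  forall i, exact_pair (tensor_map X (seq_diff C i))
                       (tensor_map X (seq_diff C (i - 1))).

Lemma tensor_diff_comp X i (w : tensor (C i) X) :
  tensor_map X (seq_diff C (i - 1)) (tensor_map X (seq_diff C i) w) = 0.
Proof. by apply: tensor_map_comp0 => x; exact: acyclic_diff_comp. Qed.

Lemma flat_tensor_acyclic X : flat X -> tensor_acyclic X.
Proof. by move=> flatX i; exact: flatX. Qed.

Lemma zero_tensor_acyclic X : zero_module X -> tensor_acyclic X.
Proof.
move=> X0; apply/flat_tensor_acyclic/projective_flat => Y Z p g _.
by exists (\0 : {linear X -> Y}) => x; rewrite (X0 x) !linear0.
Qed.

Section ShortExact.
Variables (K X Y : lmodType A) (i : {linear K -> Y}) (p : {linear Y -> X}).
Hypotheses (i_inj : injective i) (exip : exact_pair i p) (p_surj : surj p).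

(** As the terms of [C] are projective, tensoring with [C] gives a short exact sequence of
    complexes; this lemma and the next are chases in it. *)
Lemma tensor_acyclic_quot :
  tensor_acyclic K -> tensor_acyclic Y -> tensor_acyclic X.
Proof.
move=> TK TY k z; split=> [dz|[w <-]]; last exact: tensor_diff_comp.
have [y yz] := tensor_mapr_surj (P := C (k - 1)) p_surj z.
have exC l := tensor_mapr_exact (@projC l) exip.
have /exC[u uE] : tensor_mapr _ p (tensor_map Y (seq_diff C (k - 1)) y) = 0.
  by rewrite -tensor_mapC yz.
have /TK[v vE] : tensor_map K (seq_diff C (k - 1 - 1)) u = 0.
  apply: (tensor_mapr_inj (@projC _) i_inj).
  by rewrite -tensor_mapC uE tensor_diff_comp linear0.
have /TY[y' y'E] :
    tensor_map Y (seq_diff C (k - 1)) (y - tensor_mapr _ i v) = 0.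
  by rewrite linearB /= tensor_mapC vE uE subrr.
exists (tensor_mapr _ p y'); rewrite tensor_mapC y'E linearB yz /=.
by rewrite (exC _ _).2 ?subr0 //; exists v.
Qed.

Lemma tensor_acyclic_ext :
  tensor_acyclic K -> tensor_acyclic X -> tensor_acyclic Y.
Proof.
move=> TK TX k y; split=> [dy|[w <-]]; last exact: tensor_diff_comp.
have exC l := tensor_mapr_exact (@projC l) exip.
have /TX[x xE] : tensor_map X (seq_diff C (k - 1)) (tensor_mapr _ p y) = 0.
  by rewrite tensor_mapC dy linear0.
have [y' y'x] := tensor_mapr_surj (P := C k) p_surj x.
have /exC[u uE] : tensor_mapr _ p (y - tensor_map Y (seq_diff C k) y') = 0.
  by rewrite linearB /= -tensor_mapC y'x xE subrr.
have /TK[v vE] : tensor_map K (seq_diff C (k - 1)) u = 0.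
  apply: (tensor_mapr_inj (@projC _) i_inj).
  by rewrite -tensor_mapC uE linearB /= dy tensor_diff_comp subrr linear0.
exists (y' + tensor_mapr _ i v).
by rewrite linearD /= tensor_mapC vE uE subrKC.
Qed.

End ShortExact.

Lemma pd_finite_tensor_acyclic X : pd_finite X -> tensor_acyclic X.
Proof.
move=> [n [F [projF F0]]]; apply: (resolution_ind (F := F) (n := n)) => //.
- exact: zero_tensor_acyclic.
- by move=> K Y Z i p; exact: tensor_acyclic_quot.
- by move=> k; exact/flat_tensor_acyclic/projective_flat.
Qed.

End TensorAcyclic.

(** * Modules [X] for which Hom(C, X) is acyclic *)

Section ColiftableModules.
Variables (A : comPzRingType) (C : sequence A).

Definition coliftable (X : lmodType A) : Prop :=
  forall i (u : {linear C (i - 1) -> X}), (forall c, u (seq_diff C i c) = 0) ->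
  exists v : {linear C (i - 1 - 1) -> X},
    forall c, v (seq_diff C (i - 1) c) = u c.

Lemma coliftableP (X : lmodType A) : acyclic C ->
  coliftable X <-> Hom_to_exact C X.
Proof.
move=> acC; split=> [LX i h|LX i u du].
  split=> [dh|[v <-]].
    have [|v vE] := LX i h; last by exists v; apply: homP => x; exact: vE.
    by move=> x; exact: (congr1 (fun f : hom _ _ => f x) dh).
  apply: homP => x; rewrite /= acyclic_diff_comp //; exact: linear0.
have [h _] := LX i u.
have [|v vE] := h; first by apply: homP => x; exact: du.
by exists v => x; exact: (congr1 (fun f : hom _ _ => f x) vE).
Qed.

Lemma zero_coliftable X : zero_module X -> coliftable X.
Proof. by move=> X0 i u _; exists (\0 : {linear _ -> X}) => c; rewrite [RHS]X0. Qed.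

Lemma coliftable_retract (X Y : lmodType A) (s : {linear X -> Y})
    (r : {linear Y -> X}) :
  (forall x, r (s x) = x) -> coliftable Y -> coliftable X.
Proof.
move=> sK LY i u du.
have [c|v vE] := LY i (s \o u); first by rewrite /= du linear0.
by exists (r \o v) => c /=; rewrite vE /= sK.
Qed.

Hypotheses (acC : acyclic C) (projC : forall i, projective (C i)).

Section ShortExact.
Variables (K X Y : lmodType A) (i : {linear K -> Y}) (p : {linear Y -> X}).
Hypotheses (i_inj : injective i) (exip : exact_pair i p) (p_surj : surj p).

(** [u] lifts to [u'] with values in [Y]. Composed with the differential, [u'] lands in [K] and
    there extends to [z]; then [u'] minus [z] extends in [Y], and projecting this extends [u]. *)
Lemma coliftable_quot : coliftable K -> coliftable Y -> coliftable X.
Proof.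
move=> LK LY k; rewrite -(addrK 1 k) => u du.
have [u' u'E] := @projC _ _ _ p u p_surj.
have [c|w wE] := factor_through_inj
    (f := u' \o seq_diff C (k + 1 - 1)) i_inj.
  by apply/exip; have /= -> := u'E (seq_diff C (k + 1 - 1) c).
have [c|z zE] := LK _ w.
  by apply: i_inj; rewrite wE /= acyclic_diff_comp // !linear0.
have [c|t tE] := LY _ (u' \- (i \o z)).
  by rewrite /= zE wE subrr.
exists (p \o t) => c /=; rewrite tE linearB /=.
by rewrite (exip (i (z c))).2 ?subr0; [exact: u'E | exists (z c)].
Qed.

(** An extension of [p \o u] lifts to [Y] by projectivity; its error against [u] lies in [K] and is
    corrected there. *)
Lemma coliftable_ext : coliftable K -> coliftable X -> coliftable Y.
Proof.
move=> LK LX k u du.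
have [c|v vE] := LX k (p \o u); first by rewrite /= du linear0.
have [v' v'E] := @projC _ _ _ p v p_surj.
have [c|w wE] := factor_through_inj
    (f := (u \- (v' \o seq_diff C (k - 1)))) i_inj.
  apply/exip; rewrite /= linearB /=.
  by have /= -> := v'E (seq_diff C (k - 1) c); rewrite vE subrr.
have [c|z zE] := LK k w.
  by apply: i_inj; rewrite wE /= du acyclic_diff_comp // !linear0 addr0.
exists (v' \+ (i \o z)) => c /=.
by rewrite zE wE /= subrKC.
Qed.

End ShortExact.

End ColiftableModules.

Section DirectPowerMap.
Variables (A : comPzRingType) (I : choiceType).
Implicit Types X Y Z : lmodType A.

Lemma dpow_map X Y (g : {linear X -> Y}) :
  {h : {linear dpow I X -> dpow I Y} |
    forall f i, dcoord i (h f) = g (dcoord i f)}.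
Proof.
apply: cid; have /choice[h hE] (f : dpow I X) :
    exists f' : dpow I Y, forall i, dcoord i f' = g (dcoord i f).
  apply: (dpow_of (s := dsupp f)) => i /dsuppP->; exact: linear0.
have hl : linear h.
  by move=> a u v; apply: dpowP => i; rewrite linearP /= !hE !linearP.
by exists (lin_of hl).
Qed.

Lemma dpow_map_inj X Y (g : {linear X -> Y}) :
  injective g -> injective (sval (dpow_map g)).
Proof.
move=> g_inj u v e; apply: dpowP => i; apply: g_inj.
by rewrite -!(svalP (dpow_map g)) e.
Qed.

Lemma dpow_preimage X Y (g : {linear X -> Y}) (f : dpow I Y) :
    (forall i, exists x, g x = dcoord i f) ->
  exists f', sval (dpow_map g) f' = f.
Proof.
(* The preimage is [0] wherever [f] vanishes, which keeps the support finite. *)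
move=> gf; have /choice[c cE] (i : I) : exists x,
    g x = dcoord i f /\ (dcoord i f = 0 -> x = 0).
  have [f0|f0] := eqVneq (dcoord i f) 0.
    by exists 0; rewrite linear0 f0.
  by have [x xE] := gf i; exists x; split=> // /eqP; rewrite (negPf f0).
have [|f' f'E] := @dpow_of _ _ X c (dsupp f).
  by move=> i /dsuppP; case: (cE i) => _; exact.
exists f'; apply: dpowP => i; rewrite (svalP (dpow_map g)) f'E.
by case: (cE i).
Qed.

Lemma dpow_map_surj X Y (g : {linear X -> Y}) :
  surj g -> surj (sval (dpow_map g)).
Proof. by move=> g_surj f; apply: dpow_preimage => i; exact: g_surj. Qed.

Lemma dpow_map_exact X Y Z (g : {linear X -> Y}) (h : {linear Y -> Z}) :
  exact_pair g h -> exact_pair (sval (dpow_map g)) (sval (dpow_map h)).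
Proof.
move=> exgh f; split=> [hf|[f' <-]].
  apply: dpow_preimage => i; apply/exgh.
  by rewrite -(svalP (dpow_map h)) hf linear0.
apply: dpowP => i; rewrite linear0 (svalP (dpow_map h)) (svalP (dpow_map g)).
by apply/exgh; exists (dcoord i f').
Qed.

End DirectPowerMap.

Section DirectPowerColiftable.
Variables (A : comPzRingType) (C : sequence A) (I : choiceType).
Hypotheses (acC : acyclic C) (projC : forall i, projective (C i)).
Hypothesis Cproj : forall Q, projective Q -> Hom_to_exact C Q.

Lemma projective_dpow_coliftable X : projective X -> coliftable C (dpow I X).
Proof. by move=> projX; apply/coliftableP => //; apply/Cproj/dpow_projective. Qed.

(** Direct sums are part of the property carried along the resolution, as Hom(C, -) need not commute
    with infinite ones. *)
Lemma pd_finite_dpow_coliftable X : pd_finite X -> coliftable C (dpow I X).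
Proof.
move=> [n [F [projF F0]]].
apply: (@resolution_ind _ (fun X => coliftable C (dpow I X)) _ F n) => //.
- move=> Z Z0; apply: zero_coliftable => f.
  by apply: dpowP => i; rewrite (Z0 (dcoord i f)) linear0.
- move=> K Y Z i p i_inj exip p_surj; apply: coliftable_quot => //.
  + exact: (dpow_map_inj i_inj).
  + exact: dpow_map_exact.
  + exact: dpow_map_surj.
- by move=> k; exact: projective_dpow_coliftable.
Qed.

End DirectPowerColiftable.

(** * Extension of scalars *)

Section Extension.
Variables (A B : comPzRingType) (f : {rmorphism A -> B}).

Lemma extscal_adjoint (X : lmodType A) (Z : lmodType B)
    (g : {linear X -> restr Z f}) :
  exists h : {linear extscal f X -> Z},
    forall x (s : algmod f),
      h (@tens A X (algmod f) x s) = (s : B) *: (g x : Z).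
Proof.
pose phi (x : X) (s : algmod f) : Z := (s : B) *: (g x : Z).
have phiB : balanced phi.
  split=> [x y s|x s t|a x s]; rewrite /phi.
  - by rewrite linearD -scalerDr.
  - exact: scalerDl.
  - rewrite linearZ -[LHS]/((s : B) *: (f a *: (g x : Z))).
    by rewrite scalerA mulrC.
have hl : linear (tensor_lift phi : extscal f X -> Z).
  move=> b u v; rewrite (tensor_liftD phiB); congr (_ + _).
  move: u; apply: tensor_morph_ext => [u w|u w|x s].
  - rewrite -(tensor_liftD phiB); congr (tensor_lift phi _).
    exact: (scalerDr b (u : extscal f X) w).
  - by rewrite (tensor_liftD phiB) scalerDr.
  - rewrite [X in tensor_lift _ X](extscal_scale_tens b x s).
    by rewrite !tensor_lift_tens // /phi scalerA.
by exists (lin_of hl) => x s; exact: tensor_lift_tens.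
Qed.

Lemma extscal_tens (X : lmodType A) (x : X) (s : B) :
  @tens A X (algmod f) x s = s *: (@tens A X (algmod f) x (1 : B) : extscal f X).
Proof. by rewrite [RHS]extscal_scale_tens mulr1. Qed.

Lemma extscal_ext (X : lmodType A) (Z : lmodType B)
    (g h : {linear extscal f X -> Z}) :
    (forall x, g (@tens A X (algmod f) x (1 : B)) =
               h (@tens A X (algmod f) x (1 : B))) ->
  g =1 h.
Proof.
move=> gh; apply: (@tensor_morph_ext A X (algmod f)) => [u v|u v|x s].
- exact: linearD.
- exact: linearD.
- by rewrite extscal_tens !linearZ /= gh.
Qed.

Fact extscal_unit_linear (X : lmodType A) :
  linear (fun x : X => @tens A X (algmod f) x (1 : B) : restr (extscal f X) f).
Proof.
move=> a x y; rewrite tensDl; congr (_ + _).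
rewrite tensZ -[RHS]/(f a *: (@tens A X (algmod f) x (1 : B) : extscal f X)).
by rewrite [RHS]extscal_scale_tens.
Qed.

Definition extscal_unit (X : lmodType A) : {linear X -> restr (extscal f X) f} :=
  lin_of (@extscal_unit_linear X).

(** Extension of scalars is left adjoint to restriction, which preserves surjections. *)
Lemma extscal_projective (X : lmodType A) :
  projective X -> projective (extscal f X).
Proof.
move=> projX Y Z p g p_surj.
have [h hE] := projX (restr Y f) (restr Z f) (restr_map f p)
  (restr_map f g \o extscal_unit X) p_surj.
have [k kE] := extscal_adjoint h; exists k.
apply: extscal_ext => x; rewrite /= kE scale1r; exact: hE.
Qed.

Definition extscal_map (X Y : lmodType A) (g : {linear X -> Y}) :
  extscal f X -> extscal f Y := tensor_map (algmod f) g.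

Fact extscal_map_linear (X Y : lmodType A) (g : {linear X -> Y}) :
  linear (extscal_map g).
Proof.
have D := linearD (tensor_map (algmod f) g).
move=> b u v; rewrite [LHS]D; congr (_ + _).
move: u; apply: (@tensor_morph_ext A X (algmod f)) => [u w|u w|x s].
- rewrite -[RHS]D; congr (extscal_map g _).
  exact: (scalerDr b (u : extscal f X) w).
- by rewrite [extscal_map g (u + w)]D scalerDr.
- have gT t : extscal_map g (@tens A X (algmod f) x t) = tens (g x) t.
    exact: tensor_map_tens.
  transitivity (extscal_map g (@tens A X (algmod f) x (b * (s : B)))).
    by congr (extscal_map g _); exact: extscal_scale_tens.
  by rewrite !gT [RHS]extscal_scale_tens.
Qed.
HB.instance Definition _ (X Y : lmodType A) (g : {linear X -> Y}) :=
  GRing.isLinear.Build B (extscal f X) (extscal f Y) _ (extscal_map g)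
    (extscal_map_linear g).

(** A dual basis over [B] makes [restr Q f] a retract of a direct sum of copies of [algmod f]:
    coordinates are the section, linear combinations the retraction. *)
Lemma projective_restr_coliftable (C : sequence A) (Q : lmodType B) :
    (forall I, coliftable C (dpow I (algmod f))) -> projective Q ->
  coliftable C (restr Q f).
Proof.
move=> LB projQ; have [c cE] := projective_dual_basis projQ.
have /choice[s sE] (x : restr Q f) :
    exists y : dpow Q (algmod f), forall q, dcoord q y = dcoord q (c x).
  by apply: (dpow_of (s := dsupp (c x))) => q /dsuppP.
have sl : linear s.
  move=> a x y; apply: dpowP => q; rewrite linearP /= !sE.
  by rewrite -[a *: x]/(f a *: (x : Q)) !linearP.
have gl (q : Q) : linear (fun b : algmod f => (b : B) *: q : restr Q f).
  by move=> a x y; rewrite [LHS]scalerDl; congr (_ + _); rewrite /= -scalerA.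
have [r rE] := dpow_univ (fun q => lin_of (gl q)).
apply: (coliftable_retract (s := lin_of sl) (r := r)) (LB Q) => x /=.
rewrite (dpow_suppE (s x)) linear_sum.
under eq_bigr do rewrite rE /= sE.
rewrite [RHS](cE x (dsupp (s x))) ?dsupp_uniq // => q.
by move=> /dsuppP; rewrite sE.
Qed.

End Extension.

Arguments extscal_map {A B} f {X Y} g.

(* [M (x) B] is the image of [C_0 (x) B -> C_(-1) (x) B] by right exactness
   and the acyclicity of [C (x) B]. *)
Lemma Gorenstein_projective_extscal (A B : comPzRingType)
    (f : {rmorphism A -> B}) (M : lmodType A) :
    (forall C : sequence A, acyclic C -> (forall i, projective (C i)) ->
       tensor_acyclic C (algmod f)) ->
    (forall (C : sequence A) I, acyclic C -> (forall i, projective (C i)) ->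
       (forall Q, projective Q -> Hom_to_exact C Q) ->
       coliftable C (dpow I (algmod f))) ->
    Gorenstein_projective M -> Gorenstein_projective (extscal f M).
Proof.
move=> TB LB [C [acC projC Cproj [phi phi_inj phiE]]].
pose D := Sequence (fun i => extscal_map f (seq_diff C i) :
  {linear extscal f (C i) -> extscal f (C (i - 1))}).
have acD : acyclic D := TB C acC projC.
exists D; split=> //.
- by move=> i; apply: extscal_projective; exact: projC.
- move=> Q projQ; apply/(coliftableP _ acD) => i u du.
  have LQ : coliftable C (restr Q f).
    by apply: projective_restr_coliftable projQ => I; exact: LB.
  have [c|v vE] := LQ i (restr_map f u \o extscal_unit f _).
    rewrite -[RHS](du (@tens A _ (algmod f) c (1 : B))); congr (u _).
    by rewrite [RHS]tensor_map_tens.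
  have [w wE] := extscal_adjoint v; exists w.
  apply: (@extscal_ext _ _ f _ _ (w \o extscal_map f (seq_diff C (i - 1))) u) => c.
  rewrite /= [X in w X]tensor_map_tens wE scale1r.
  exact: vE.
(* Through [phi], the differential becomes a surjection [q] from [C 0] onto [M]. *)
- have [|q qE] := factor_through_inj (f := seq_diff C 0) phi_inj.
    by move=> c; apply/phiE; exists c.
  have q_surj : surj q.
    move=> m; have /phiE[c cE] : exists n, phi n = phi m by exists m.
    by exists c; apply: phi_inj; rewrite qE.
  have phiq w : tensor_map (algmod f) phi (tensor_map (algmod f) q w) =
      tensor_map (algmod f) (seq_diff C 0) w.
    move: w; apply: tensor_morph_ext => [u v|u v|c s]; do ?by rewrite !linearD.
    by rewrite [X in tensor_map _ _ X]tensor_map_tens !tensor_map_tens qE.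
  exists (extscal_map f phi).
    move=> u v e; apply/subr0_eq.
    have [w wE] := tensor_map_surj (X := algmod f) q_surj (u - v).
    (* Exactness at [C 0] involves the differentials of degrees [1] and [1 - 1], hence the index
       [1]. *)
    have ac0 := TB C acC projC 1.
    have [|w' w'E] := (ac0 w).1.
      rewrite -[LHS]phiq wE; apply/eqP.
      by rewrite (linearB (extscal_map f phi)) subr_eq0; apply/eqP.
    rewrite -wE -w'E; apply: tensor_map_comp0 => c; apply: phi_inj.
    by rewrite qE linear0; exact: (acyclic_diff_comp (i := 1)).
  move=> y; split=> [[u <-]|[w <-]].
    have [w <-] := tensor_map_surj (X := algmod f) q_surj u.
    by exists w; rewrite -[LHS]phiq.
  by exists (tensor_map (algmod f) q w); exact: phiq.
Qed.

(** * The trivial extension as a module extension of [A] by [E] *)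

Section TrivialExtension.
Variables (A : comPzRingType) (E : lmodType A).
Local Notation R := (algmod (trivext_in E)).

Fact trivext_inr_linear : linear (fun e : E => (0, e) : R).
Proof.
move=> a x y; have -> := algmod_trivextE a 0 x.
by congr pair; rewrite /= mulr0 addr0.
Qed.

Definition trivext_inr : {linear E -> R} := lin_of trivext_inr_linear.

Fact trivext_fst_linear : linear (fun x : R => (x : trivext E).1 : A^o).
Proof. by move=> a [b e] [c d]; have -> := algmod_trivextE a b e. Qed.

Definition trivext_fst : {linear R -> A^o} := lin_of trivext_fst_linear.

Lemma trivext_inr_inj : injective trivext_inr.
Proof. by move=> x y []. Qed.

Lemma trivext_fst_surj : surj trivext_fst.
Proof. by move=> a; exists ((a, 0) : trivext E). Qed.

Lemma trivext_exact : exact_pair trivext_inr trivext_fst.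
Proof. by move=> [a e]; split=> [/= ->|[d [<- _]]] //; exists e. Qed.

(** Both ends of the sequence are acyclic after tensoring: [E] by its finite projective dimension
    and [A^o] by flatness. *)
Lemma trivext_tensor_acyclic (C : sequence A) :
    acyclic C -> (forall i, projective (C i)) -> pd_finite E ->
  tensor_acyclic C R.
Proof.
move=> acC projC pdE.
apply: (tensor_acyclic_ext acC projC trivext_inr_inj trivext_exact
  trivext_fst_surj); first exact: pd_finite_tensor_acyclic.
exact/flat_tensor_acyclic/projective_flat/regular_projective.
Qed.

Lemma trivext_dpow_coliftable (C : sequence A) (I : choiceType) :
    acyclic C -> (forall i, projective (C i)) ->
    (forall Q, projective Q -> Hom_to_exact C Q) -> pd_finite E ->
  coliftable C (dpow I R).
Proof.
move=> acC projC Cproj pdE.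
apply: (coliftable_ext acC projC (dpow_map_inj trivext_inr_inj)
  (dpow_map_exact trivext_exact) (dpow_map_surj trivext_fst_surj)).
  exact: pd_finite_dpow_coliftable.
exact/projective_dpow_coliftable/regular_projective.
Qed.

End TrivialExtension.

Close Scope classical_set_scope.
Close Scope ring_scope.

Theorem corollary2p3 (A : comPzRingType) (E M : lmodType A) :
  (pd_finite E ->
   Gorenstein_projective M ->
   Gorenstein_projective (extscal (trivext_in E) M))
  /\
  ((forall p : nat, 1 <= p -> Ext_eq0 (algmod (trivext_in E)) p M) ->
   fd_finite (algmod (trivext_in E)) ->
   Gorenstein_injective M ->
   Gorenstein_injective (coextscal (trivext_in E) M)).
Proof.
split=> [pdE|_]; last exact: Gorenstein_injective_coextscal.
apply: Gorenstein_projective_extscal.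
  by move=> C acC projC; exact: trivext_tensor_acyclic.
by move=> C I acC projC Cproj; exact: trivext_dpow_coliftable.
Qed.
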